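(* Let $\beta\in(0,\alpha/4)$ be arbitrary and fixed. Let $\{I_j : j\in\mathbb{Z}_+\}$ be an arbitrary sequence of compact intervals of $\mathbb{R}$, non-increasing for inclusion ($I_j\subseteq I_{j-1}$ for all $j\ge 1$), with $\mathrm{diam}(I_j)\ge 2^{1-j/2}$ for every $j\in\mathbb{Z}_+$. For $j\in\mathbb{Z}_+$ set $\underline{H}_j=\min_{t\in I_j}H(t)$, $\nu_j=\{k\in\mathbb{Z} : [k2^{-j},(k+1)2^{-j}]\subseteq I_j\}$, $n_j=\mathrm{card}(\nu_j)$ (one has $n_j\ge 1$), and $$V_j=\frac{1}{n_j}\sum_{k\in\nu_j}|d_{j,k}|^{\beta}.$$ Assume that there exists $j_0\in\mathbb{Z}_+$ such that the uniform Hölder exponent of $H(\cdot)$ over $I_{j_0}$ satisfies $\rho_H^{\mathrm{unif}}(I_{j_0})>\max_{t\in I_{j_0}}H(t)$. Then, almost surely, $$\lim_{j\to+\infty}\left|\frac{\log_2(V_j)}{-j\beta}-\underline{H}_j\right|=0.$$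
   Context: Fix $\alpha\in(1,2)$. $\{Z_\alpha(s):s\in\mathbb{R}\}$ is a symmetric $\alpha$-stable (S$\alpha$S) Lévy process with càdlàg paths on a probability space $(\Omega,\mathcal{F},\mathbb{P})$, normalized so that for $f\in L^\alpha(\mathbb{R})$ the stable stochastic integral $\int_{\mathbb{R}}f(s)\,Z_\alpha(ds)$ has characteristic function $\xi\mapsto\exp(-|\xi|^\alpha\int_{\mathbb{R}}|f(s)|^\alpha ds)$. For real $x,\kappa$, $(x)_+^\kappa=x^\kappa$ if $x>0$ and $(x)_+^\kappa=0$ otherwise. $X=\{X(u,v):(u,v)\in\mathbb{R}\times(1/\alpha,1)\}$ is the S$\alpha$S field $X(u,v)=\int_{\mathbb{R}}\{(u-s)_+^{v-1/\alpha}-(-s)_+^{v-1/\alpha}\}Z_\alpha(ds)$. It is always taken in a version (known to exist, $\Omega$ being suitably chosen) such that for every $\omega\in\Omega$ the path $(u,v)\mapsto X(u,v,\omega)$ is continuous and, for all compact intervals $\mathcal{I}\subset\mathbb{R}$, $\mathcal{H}\subset(1/\alpha,1)$, $\sup\{|X(u,v_1,\omega)-X(u,v_2,\omega)|/|v_1-v_2| : u\in\mathcal{I},\,v_1,v_2\in\mathcal{H}\}<+\infty$ (convention $0/0=0$). $H:\mathbb{R}\to[\underline{H},\overline{H}]$ is a continuous function, where $[\underline{H},\overline{H}]$ is a compact subinterval of $(1/\alpha,1)$. The Linear Multifractional Stable Motion is $Y(t)=X(t,H(t))$, $t\in\mathbb{R}$. The analyzing wavelet $\psi:\mathbb{R}\to\mathbb{R}$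 is continuous, not identically zero, vanishes outside $[0,1]$, and satisfies $\int_{\mathbb{R}}\psi(s)ds=\int_{\mathbb{R}}s\psi(s)ds=0$. The wavelet coefficients of $Y$ are $d_{j,k}=2^j\int_{\mathbb{R}}Y(t)\psi(2^jt-k)\,dt$, $(j,k)\in\mathbb{Z}^2$. For a compact interval $I$ with non-empty interior and a continuous $g:\mathbb{R}\to\mathbb{R}$, the uniform Hölder exponent is $\rho_g^{\mathrm{unif}}(I)=\sup\{\gamma\in[0,1] : \sup_{t_1,t_2\in I}|g(t_1)-g(t_2)|/|t_1-t_2|^\gamma<+\infty\}$. *)

(* Defs.v *)
From HB Require Import structures.
From mathcomp Require Import all_boot all_order all_algebra finmap.
From mathcomp Require Import all_classical all_reals all_analysis.

Set Implicit Arguments.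
Unset Strict Implicit.
Unset Printing Implicit Defensive.

Import Order.TTheory GRing.Theory Num.Theory.
Import numFieldNormedType.Exports.

Local Open Scope classical_set_scope.
Local Open Scope ring_scope.

Section StableIntegral.
Context {d : measure_display} {Omega : measurableType d} {R : realType}.
Variable P : probability Omega R.

(* Since the A i are arbitrary (possibly setT), the product rule over the full
   family of increments contains the product rule over every subfamily. *)
Definition independent_increments (Z : R -> Omega -> R) : Prop :=
  forall (n : nat) (t : nat -> R) (A : nat -> set R),
    (forall i, (i < n)%N -> t i <= t i.+1) ->
    (forall i, measurable (A i)) ->
    fine (P [set w | forall i, (i < n)%N -> A i (Z (t i.+1) w - Z (t i) w)]) =
    \prod_(i < n) fine (P [set w | A i (Z (t i.+1) w - Z (t i) w)]).

Definition stationary_increments (Z : R -> Omega -> R) : Prop :=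
  forall (s h : R) (A : set R), 0 <= h -> measurable A ->
    P [set w | A (Z (s + h) w - Z s w)] = P [set w | A (Z h w - Z 0 w)].

Definition cadlag (z : R -> R) : Prop :=
  forall t, z s @[s --> t^'+] --> z t /\ cvg (z s @[s --> t^'-]).

Definition levy_process (Z : R -> {RV P >-> R}) : Prop :=
  [/\ (\forall w \ae P, Z 0 w = 0),
      independent_increments Z,
      stationary_increments Z
    & forall w, cadlag (fun t => Z t w)].

Definition cvg_in_probability (Y : nat -> Omega -> R) (Y0 : Omega -> R) : Prop :=
  forall e : R, 0 < e ->
    (fun n => P [set w | e <= `|Y n w - Y0 w|]) @ \oo --> 0%E.

(* An element (c, (a, b)) of a step sequence stands for c * 1_{]a, b]}. *)
Definition step := seq (R * (R * R)).

Definition wf_step (s : step) : bool := all (fun p => p.2.1 <= p.2.2) s.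

Definition step_fun (s : step) (x : R) : R :=
  \sum_(p <- s) p.1 * \1_(`]p.2.1, p.2.2]%classic) x.

Definition step_integral (Z : R -> Omega -> R) (s : step) (w : Omega) : R :=
  \sum_(p <- s) p.1 * (Z p.2.2 w - Z p.2.1 w).

(* [I] is a version of the integral of [f] against Z(ds): a limit in
   probability of integrals of step functions converging to [f] in L^alpha.
   For a stable process the limit is a.s. independent of the sequence. *)
Definition is_stable_integral (alpha : R) (Z : R -> Omega -> R)
    (f : R -> R) (I : Omega -> R) : Prop :=
  [/\ f \in Lfun (@lebesgue_measure R) alpha%:E,
      measurable_fun setT I
    & exists s : nat -> step,
      [/\ (forall n, wf_step (s n)),
          (fun n => 'N[@lebesgue_measure R]_(alpha%:E)
                      [EFin \o (f \- step_fun (s n))%R])%E @ \oo --> 0%E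
        & cvg_in_probability (fun n => step_integral Z (s n)) I]].

(* The two equations are the real and imaginary parts of
   E[exp(i xi I)] = exp(-|xi|^alpha \int |f|^alpha). *)
Definition SaS_normalized (alpha : R) (Z : R -> Omega -> R) : Prop :=
  forall (f : R -> R) (I : Omega -> R), is_stable_integral alpha Z f I ->
  forall xi : R,
    'E_P[fun w => cos (xi * I w)]%E =
      (expR (- (`|xi| `^ alpha *
        \int[@lebesgue_measure R]_s (`|f s| `^ alpha))))%:E
    /\ 'E_P[fun w => sin (xi * I w)]%E = 0%E.

End StableIntegral.

Section Field.
Context {R : realType}.

Definition pospow (x kappa : R) : R := if 0 < x then x `^ kappa else 0.

Definition lmsm_kernel (alpha u v s : R) : R :=
  pospow (u - s) (v - alpha^-1) - pospow (- s) (v - alpha^-1).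

(* In the quotients below, and in [unif_holder], 0 / 0 = 0 since 0^-1 = 0. *)
Definition regular_path (alpha : R) (x : R -> R -> R) : Prop :=
  {within [set uv : R * R | alpha^-1 < uv.2 < 1],
     continuous (fun uv : R * R => x uv.1 uv.2)} /\
  forall a b c c' : R, alpha^-1 < c -> c' < 1 ->
    (ereal_sup [set (`|x p.1 p.2.1 - x p.1 p.2.2| / `|p.2.1 - p.2.2|)%:E
               | p in `[a, b] `*` (`[c, c'] `*` `[c, c'])] < +oo)%E.

Definition SaS_field {d : measure_display} {Omega : measurableType d}
    (P : probability Omega R) (alpha : R) (Z : R -> Omega -> R)
    (X : R -> R -> Omega -> R) : Prop :=
  (forall u v : R, alpha^-1 < v < 1 ->
     is_stable_integral P alpha Z (lmsm_kernel alpha u v) (X u v)) /\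
  (forall w, regular_path alpha (fun u v => X u v w)).

Definition lmsm {Omega : Type} (X : R -> R -> Omega -> R) (H : R -> R)
  (t : R) (w : Omega) : R := X t (H t) w.

Definition analyzing_wavelet (psi : R -> R) : Prop :=
  [/\ continuous psi,
      (exists x, psi x != 0),
      (forall x, x \notin `[0, 1] -> psi x = 0),
      \int[@lebesgue_measure R]_s psi s = 0
    & \int[@lebesgue_measure R]_s (s * psi s) = 0].

Definition wavelet_coeff (psi y : R -> R) (j k : int) : R :=
  2 ^ j * \int[@lebesgue_measure R]_t (y t * psi (2 ^ j * t - k%:~R)).

Definition unif_holder (g : R -> R) (I : set R) : R :=
  sup [set gamma : R | 0 <= gamma <= 1 /\
    (ereal_sup [set (`|g p.1 - g p.2| / `|p.1 - p.2| `^ gamma)%:E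
               | p in I `*` I] < +oo)%E].

(* For continuous g and a nonempty compact I these are attained. *)
Definition max_on (g : R -> R) (I : set R) : R := sup (g @` I).
Definition min_on (g : R -> R) (I : set R) : R := inf (g @` I).

Definition nu (I : set R) (j : int) : set int :=
  [set k : int | `[k%:~R * 2 ^ (- j), (k + 1)%:~R * 2 ^ (- j)] `<=` I].

Definition V_stat (beta : R) (psi y : R -> R) (I : set R) (j : int) : R :=
  (#|` fset_set (nu I j)|%fset)%:R^-1 *
  \sum_(k \in nu I j) `|wavelet_coeff psi y j k| `^ beta.

(* [ln 0 = 0] rather than -oo.  The limits of interest are insensitive to
   this: if V_j = 0 then |log2 V_j / (- j beta) - h_j|, with h_j > 1 / alpha,
   is +oo for log2 0 = -oo and h_j for log2 0 = 0, hence bounded away from 0. *)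
Definition log2 (x : R) : R := ln x / ln 2.

End Field.

(* Main.v *)
(** Freeze [H] at the left end of each dyadic interval.  The frozen wavelet coefficient is a
    limit of finite combinations [D_n] of values of the field, with weights (the
    integrals of the wavelet over small cells) that sum exactly to zero; [D_n] is
    a stable integral of an explicit kernel, which after rescaling no longer
    depends on the dyadic interval.  Bounding the [L^alpha] norm of that kernel
    from above and from below, uniformly in the exponent, gives two-sided bounds
    for the characteristic function of the coefficient divided by
    [2^(- j v)], hence a bound for its moment of order [beta] and a
    small ball estimate.

    Only the exponential rate of [V_j] is asked for, so first moments suffice,
    without any independence: by Markov's inequality and summation over [j],
    almost surely [V_j] is eventually at most [2^(- j beta (H_j - eps))], and most
    of the coefficients at points where [H] is within [eps] of its minimum
    [H_j] have size at least [2^(- j (H_j + 3 eps))]; these points are a fixed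
    fraction of all.  Freezing [H] costs [O(2^(- j g))] with
    [g] larger than the maximum of [H], which is negligible.  *)

Require Import Defs.
From HB Require Import structures.
From mathcomp Require Import all_boot all_order all_algebra finmap.
From mathcomp Require Import all_classical all_reals all_analysis.
From mathcomp Require Import measurable_realfun zify ring lra.

Set Implicit Arguments.
Unset Strict Implicit.
Unset Printing Implicit Defensive.

Import Order.TTheory GRing.Theory Num.Theory.
Import numFieldNormedType.Exports.

Local Open Scope classical_set_scope.
Local Open Scope ring_scope.

(** Characteristic functions are known only for stable integrals of deterministic kernels, while a
    wavelet coefficient integrates a path; the finite combinations avoid a stochastic Fubini
    theorem, and bounds uniform in [n] survive the limit. From above, the zero sum of the weights
    makes the kernel decay like |y|^(k - 1), whose [alpha]-th power is integrable at infinity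
    because [v < 1]. From below, the kernel is paired with (y - z)_+^(1 - k): a beta integral turns
    every exponent [k] into the same truncated square (t - z)_+^2, up to a factor bounded away from
    0. It then suffices that one number, the moment of [psi] against (x - z)_+^2, is nonzero for
    some [z]; third differences of truncated squares are bumps, and one of them fits where [psi] has
    constant sign. Probability enters through cosines only, so neither densities nor inversion
    formulas occur. *)

(** * Affine change of variable for the Lebesgue integral *)

Section AffineChangeOfVariable.
Context {R : realType}.
Notation mu := (@lebesgue_measure R).
Variables (c e : R) (c0 : 0 < c).

Let phi : measurableTypeR R -> measurableTypeR R := fun x => c * x + e.

Let mphi : measurable_fun setT phi.
Proof. by apply: measurable_funD => //; exact: measurable_funM. Qed.

Let nu0 : {measure set (measurableTypeR R) -> \bar R} :=
  measure_function_pushforward__canonical__measure_function_Measure mu mphi.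

Let nu1 : {measure set (measurableTypeR R) -> \bar R} :=
  mscale (NngNum (ltW c0)) nu0.

(** Uniqueness of Lebesgue measure: the preimage of a half-open interval has its length divided by
    [c], and [mscale] restores it. *)
Let nu1E (A : set R) : measurable A -> nu1 A = mu A.
Proof.
move=> mA; apply/esym/lebesgue_measure_unique => //= _ [[a b]] _ <-.
rewrite /mscale/= /pushforward.
rewrite (_ : phi @^-1` _ = `]((a - e) / c), ((b - e) / c)]%classic); last first.
  apply/seteqP; split=> x /=; rewrite !in_itv/= /phi.
    by rewrite ltr_pdivrMr// ler_pdivlMr// ltrBlDr lerBrDr mulrC.
  by rewrite ltr_pdivrMr// ler_pdivlMr// ltrBlDr lerBrDr mulrC.
rewrite !lebesgue_measure_itv/= !lte_fin ltr_pM2r ?invr_gt0// ltrD2r.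
case: ifPn => ab; last by rewrite mule0.
by rewrite -EFinD -EFinM; congr EFin; field; rewrite gt_eqF.
Qed.

Lemma ge0_integral_affine (f : R -> \bar R) :
  measurable_fun setT f -> (forall x, 0 <= f x)%E ->
  (\int[mu]_x f x = c%:E * \int[mu]_x f (c * x + e)%R)%E.
Proof.
move=> mf f0; transitivity (\int[nu1]_x f x)%E.
  by apply: eq_measure_integral => A mA _; rewrite nu1E.
rewrite ge0_integral_mscale//.
by rewrite (ge0_integral_pushforward mphi).
Qed.

Lemma Rintegral_affine (f : R -> R) : measurable_fun setT f ->
  \int[mu]_x f x = c * \int[mu]_x f (c * x + e).
Proof.
move=> mf; rewrite /Rintegral integralE [in RHS]integralE.
have mEf : measurable_fun setT (EFin \o f) by exact/measurable_EFinP.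
rewrite (ge0_integral_affine (measurable_funepos mEf))//.
rewrite (ge0_integral_affine (measurable_funeneg mEf))//.
set I := (\int[_]_x (EFin \o f)^\+ _)%E; set J := (\int[_]_x (EFin \o f)^\- _)%E.
have cy : (c%:E * +oo = +oo)%E by rewrite mulry gtr0_sg// mul1e.
have cNy : (c%:E * -oo = -oo)%E by rewrite mulrNy gtr0_sg// mul1e.
have -> : (fun x => (f (c * x + e))%:E) =
  (EFin \o f) \o (fun x => c * x + e) by [].
rewrite funepos_comp funeneg_comp.
rewrite -/I -/J.
(* Positive and negative parts scale separately; when one of them is infinite, [fine] gives 0 on
   both sides. *)
by case: I => [p| |]; case: J => [q| |]; rewrite ?cNy ?cy//= ?mulr0// mulrBr.
Qed.

End AffineChangeOfVariable.

(** * Real-valued integrals: sums, bounded factors, dominated convergence *)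

Section RealIntegral.
Context {d : measure_display} {T : measurableType d} {R : realType}.
Variable m : {measure set T -> \bar R}.

Lemma integrable_scale (c : R) (f : T -> R) :
  m.-integrable setT (EFin \o f) ->
  m.-integrable setT (EFin \o (fun x => c * f x)).
Proof.
move=> fi; apply: eq_integrable (integrableZl measurableT c fi) => //.
Qed.

Lemma integrable_sumr (I : Type) (s : seq I) (f : I -> T -> R) :
  (forall i, m.-integrable setT (EFin \o f i)) ->
  m.-integrable setT (EFin \o (fun x => \sum_(i <- s) f i x)).
Proof.
move=> fi; apply: eq_integrable (integrable_sum measurableT s (P:=xpredT)
  (fun i _ => fi i)) => //= x _; exact: sumEFin.
Qed.

Lemma integrable_bounded_mul (M : R) (f h : T -> R) :
  m.-integrable setT (EFin \o f) -> measurable_fun setT h ->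
  (forall x, `|h x| <= M) ->
  m.-integrable setT (EFin \o (fun x => f x * h x)).
Proof.
move=> fi mh hM.
apply: (le_integrable measurableT) (integrable_scale M fi).
  apply/measurable_EFinP; apply: measurable_funM => //.
  by apply/measurable_EFinP; case/integrableP: fi.
move=> x _ /=; rewrite lee_fin !normrM mulrC ler_wpM2r//.
exact: le_trans (hM x) (ler_norm _).
Qed.

Lemma integrable_normr (f : T -> R) :
  m.-integrable setT (EFin \o f) ->
  m.-integrable setT (EFin \o (fun x => `|f x|)).
Proof. by move=> fi; apply: eq_integrable (integrable_abse fi). Qed.

Lemma Rintegral_sum (I : Type) (s : seq I) (f : I -> T -> R) :
  (forall i, m.-integrable setT (EFin \o f i)) ->
  \int[m]_x (\sum_(i <- s) f i x) = \sum_(i <- s) \int[m]_x f i x.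
Proof.
move=> fi; apply: EFin_inj; rewrite /Rintegral fineK; last first.
  exact: (integrable_fin_num measurableT (integrable_sumr s fi)).
under eq_integral do rewrite -sumEFin.
rewrite (integral_sum measurableT fi) -sumEFin; apply: eq_bigr => i _.
by rewrite fineK //; apply: integrable_fin_num; [exact: measurableT|exact: fi].
Qed.

Lemma Rdominated_convergence (f_ : nat -> T -> R) (f g : T -> R) :
  (forall n, measurable_fun setT (f_ n)) -> measurable_fun setT f ->
  (forall x, f_ ^~ x @ \oo --> f x) ->
  m.-integrable setT (EFin \o g) ->
  (forall n x, `|f_ n x| <= g x) ->
  \int[m]_x f_ n x @[n --> \oo] --> \int[m]_x f x.
Proof.
move=> mf_ mf cf ig fg.
have [|||||if_ _] := @dominated_convergence _ _ _ m _ measurableT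
  (fun n x => (f_ n x)%:E) (EFin \o f) (EFin \o g).
- by move=> n; exact/measurable_EFinP.
- exact/measurable_EFinP.
- by apply/nearW => x _; apply/fine_cvgP; split=> /=; [apply: nearW|exact: cf].
- exact: ig.
- by apply/nearW => x n _ /=; rewrite lee_fin.
move=> h; apply: fine_cvg; rewrite fineK//.
exact: (integrable_fin_num measurableT).
Qed.

End RealIntegral.

(** * Uniform subdivisions of the unit interval *)

Section Nodes.
Context {R : realType}.
Notation mu := (@lebesgue_measure R).

Definition node (n i : nat) : R := i%:R / n.+1%:R.

(** Cells are half-open, so the indices below run over [i < n.+2]: the extra cell, which starts at
    1, is there to cover the endpoint. *)
Definition cell (n i : nat) : set R := `[node n i, node n i.+1[%classic.

Lemma node_ge0 n i : 0 <= node n i.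
Proof. by rewrite divr_ge0. Qed.

Lemma node_le1 n i : (i < n.+2)%N -> node n i <= 1.
Proof. by move=> ni; rewrite ler_pdivrMr ?ltr0n// mul1r ler_nat. Qed.

Lemma cellP n i (x : R) : 0 <= x -> cell n i x <-> Num.truncn (n.+1%:R * x) = i.
Proof.
move=> x0; rewrite /cell/= in_itv/= /node ler_pdivrMr ?ltr0n// ltr_pdivlMr ?ltr0n//.
rewrite mulrC -truncn_eq ?mulr_ge0//.
by split=> [/eqP|/eqP].
Qed.

Lemma sum_cell n (h : nat -> R) (x : R) : x \in `[0, 1] ->
  \sum_(i < n.+2) h i * \1_(cell n i) x = h (Num.truncn (n.+1%:R * x)).
Proof.
rewrite in_itv/= => /andP[x0 x1].
have xn : (Num.truncn (n.+1%:R * x) < n.+2)%N.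
  rewrite truncn_lt_nat ?mulr_ge0// (@le_lt_trans _ _ n.+1%:R) ?ltr_nat//.
  by rewrite ler_piMr.
rewrite (bigD1 (Ordinal xn))//= big1 ?addr0 => [|i ni].
  by rewrite indicE mem_set ?mulr1//; exact/cellP.
rewrite indicE memNset ?mulr0// => /(cellP _ _ x0) E.
by move/negP: ni; apply; apply/eqP/val_inj => /=.
Qed.

Lemma floor_node_cvg (x : R) : 0 <= x ->
  node n (Num.truncn (n.+1%:R * x)) @[n --> \oo] --> x.
Proof.
move=> x0; apply/cvgrPdist_le => e e0.
near=> n.
rewrite /node.
have /andP[h1 h2] := truncn_itv (mulr_ge0 (ler0n R n.+1) x0).
set t := (Num.truncn _)%:R in h1 h2 *.
have n0 : 0 < n.+1%:R :> R by rewrite ltr0n.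
have E : x - t / n.+1%:R = (n.+1%:R * x - t) / n.+1%:R by field; rewrite addrC natr1 gt_eqF.
rewrite E ger0_norm ?divr_ge0 ?subr_ge0//.
rewrite ler_pdivrMr// (@le_trans _ _ 1)//.
  by move: h2; rewrite /t -natr1; lra.
rewrite mulrC -ler_pdivrMr// mul1r.
apply: (@le_trans _ _ n%:R); last by rewrite ler_nat.
by near: n; exact: nbhs_infty_ger.
Unshelve. all: by end_near. Qed.

End Nodes.

(** * Cell integrals of the wavelet and Riemann sums *)

Section Weights.
Context {R : realType}.
Notation mu := (@lebesgue_measure R).

Lemma compact_support_integrable (f : R -> R) : continuous f ->
  (forall x, x \notin `[0, 1] -> f x = 0) ->
  mu.-integrable setT (EFin \o f).
Proof.
move=> cf f0.
have -> : f = f \_ `[0, 1]%classic.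
  apply/funext => x; rewrite patchE; case: ifPn => // x01.
  by rewrite f0//; move: x01; rewrite notin_setE /= => /negP.
have -> : EFin \o (f \_ `[0, 1]%classic) = (EFin \o f) \_ `[0, 1]%classic.
  by apply/funext => x; rewrite /= !patchE; case: ifPn.
suff : mu.-integrable `[0, 1] (EFin \o f).
  by move/(integrable_mkcond (mu:=mu) (EFin \o f) (measurable_itv _)).
apply: continuous_compact_integrable; first exact: segment_compact.
exact: continuous_subspaceT.
Qed.

Variable psi : R -> R.
Hypothesis cpsi : continuous psi.
Hypothesis psi0 : forall x, x \notin `[0, 1] -> psi x = 0.

(** Cell integrals rather than sampled values of [psi]: a sampled Riemann sum would inherit the zero
    mean only in the limit, whereas these weights do so for every [n]. *)
Definition weight (n i : nat) : R := \int[mu]_x (psi x * \1_(cell n i) x).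

Let ipsi := compact_support_integrable cpsi psi0.

Lemma measurable_cell n i : measurable (@cell R n i).
Proof. exact: measurable_itv. Qed.

Let ipsi_cell n i (c : R) :
  mu.-integrable setT (EFin \o (fun x => c * (psi x * \1_(cell n i) x))).
Proof.
apply: integrable_scale; apply: (integrable_bounded_mul (M := 1)) => //.
  exact: measurable_indic (measurable_cell _ _).
by move=> x; rewrite ger0_norm// indicE; case: (_ \in _).
Qed.

Lemma sum_node_weight n (h : R -> R) :
  \sum_(i < n.+2) h (node n i) * weight n i =
  \int[mu]_x (\sum_(i < n.+2) h (node n i) * (psi x * \1_(cell n i) x)).
Proof.
rewrite Rintegral_sum//; apply: eq_bigr => i _.
rewrite RintegralZl//.
by apply: eq_integrable (@ipsi_cell n i 1) => // x _ /=; rewrite mul1r.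
Qed.

Lemma step_mul_psi n (h : nat -> R) x :
  \sum_(i < n.+2) h i * (psi x * \1_(cell n i) x) =
  psi x * h (Num.truncn (n.+1%:R * x)).
Proof.
have [x01|x01] := boolP (x \in `[0, 1]).
  rewrite -(sum_cell _ h x01) mulr_sumr; apply: eq_bigr => i _; ring.
by rewrite psi0// mul0r big1// => i _; rewrite mul0r mulr0.
Qed.

Lemma sum_weight n : \sum_(i < n.+2) weight n i = \int[mu]_x psi x.
Proof.
have := sum_node_weight n (fun=> 1).
under eq_bigr do rewrite mul1r.
move=> ->; apply: eq_Rintegral => x _.
by rewrite (step_mul_psi n (fun=> 1)) mulr1.
Qed.

Lemma sum_norm_weight n : \sum_(i < n.+2) `|weight n i| <= \int[mu]_x `|psi x|.
Proof.
have iabs : forall i, mu.-integrable setT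
    (EFin \o (fun x => `|psi x| * \1_(cell n i) x)).
  move=> i; have /integrable_abse := @ipsi_cell n i 1.
  apply: eq_integrable => // x _ /=.
  by rewrite mul1r normrM indicE; congr (_ * _)%:E; case: (_ \in _); rewrite ?normr1 ?normr0.
apply: (@le_trans _ _ (\sum_(i < n.+2) \int[mu]_x (`|psi x| * \1_(cell n i) x))).
  apply: ler_sum => i _.
  have i1 : mu.-integrable setT (EFin \o (fun x => psi x * \1_(cell n i) x)).
    by apply: eq_integrable (@ipsi_cell n i 1) => // x _ /=; rewrite mul1r.
  apply: le_trans (le_normr_Rintegral _ i1) _ => //.
  apply: le_Rintegral => //; first exact: (integrable_normr i1).
  by move=> x _; rewrite normrM ler_wpM2l// indicE; case: (_ \in _); rewrite ?normr1 ?normr0.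
rewrite -Rintegral_sum//; apply: le_Rintegral => //.
- exact: integrable_sumr.
- exact: (integrable_normr ipsi).
move=> x _.
have [x01|x01] := boolP (x \in `[0, 1]).
  rewrite -mulr_sumr (_ : \sum_(i < _) _ = 1) ?mulr1//.
  rewrite -[RHS](sum_cell n (fun=> 1) x01).
  by apply: eq_bigr => i _; rewrite mul1r.
by rewrite psi0// normr0 big1// => i _; rewrite mul0r.
Qed.

(** Dominated convergence for [psi] times the step function that freezes [h] at the left node of
    each cell. *)
Lemma riemann_cvg (h : R -> R) : continuous h ->
  \sum_(i < n.+2) h (node n i) * weight n i @[n --> \oo] -->
  \int[mu]_x (psi x * h x).
Proof.
move=> ch.
have [M hM] : exists M, forall x, x \in `[0, 1] -> `|h x| <= M.
  have cabs : {within `[0, 1], continuous (fun x => `|h x|)}.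
    apply: continuous_subspaceT => x; apply: continuous_comp; first exact: ch.
    exact: norm_continuous.
  by have [c _ hc] := EVT_max ler01 cabs; exists `|h c|.
under eq_fun do rewrite sum_node_weight.
apply: (@Rdominated_convergence _ _ _ mu
  (fun n x => \sum_(i < n.+2) h (node n i) * (psi x * \1_(cell n i) x))
  (fun x => psi x * h x) (fun x => `|M| * `|psi x|)).
- move=> n; apply: measurable_sum => i; apply: measurable_funM => //.
  apply: measurable_funM; first exact: continuous_measurable_fun.
  exact: measurable_indic (measurable_cell _ _).
- by apply: measurable_funM; exact: continuous_measurable_fun.
- move=> x; under eq_fun do rewrite (step_mul_psi _ (fun i => h (node _ i))).
  have [x01|x01] := boolP (x \in `[0, 1]); last first.
    by rewrite psi0//; under eq_fun do rewrite mul0r; rewrite mul0r; exact: cvg_cst.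
  apply: cvgMr.
  have x0 : 0 <= x by move: x01; rewrite in_itv/= => /andP[].
  exact: (cvg_comp _ _ (floor_node_cvg x0) (ch x)).
- exact: (integrable_scale _ (integrable_normr ipsi)).
- move=> n x; rewrite (step_mul_psi _ (fun i => h (node _ i))).
  have [x01|x01] := boolP (x \in `[0, 1]); last by rewrite psi0// mul0r !normr0 mulr0.
  rewrite normrM mulrC ler_wpM2r// (le_trans _ (ler_norm _))// hM//.
  rewrite in_itv/= node_ge0 node_le1//.
  move: x01; rewrite in_itv/= => /andP[x0 x1].
  rewrite truncn_lt_nat ?mulr_ge0// (@le_lt_trans _ _ n.+1%:R) ?ltr_nat//.
  by rewrite ler_piMr.
Qed.

End Weights.

(** * Integrability of power tails *)

Section PowerTail.
Context {R : realType}.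
Notation mu := (@lebesgue_measure R).

Lemma powR_negexp_cvgy (s : R) : 0 < s -> x `^ (- s) @[x --> +oo] --> (0 : R).
Proof.
move=> s0; apply/cvgr0Pnorm_le => e e0.
exists ((e^-1) `^ (s^-1)); split; first exact: num_real.
move=> x /= xM; have x0 : 0 < x by exact: le_lt_trans (powR_ge0 _ _) xM.
rewrite ger0_norm ?powR_ge0// powRN invf_ple ?posrE ?powR_gt0//.
rewrite -[leLHS]powRr1 ?invr_ge0 ?ltW// -(mulVf (lt0r_neq0 s0)) powRrM.
by rewrite gt0_ltr_powR ?nnegrE ?powR_ge0 ?(ltW x0).
Qed.

Lemma integral_powR_itvcy (p : R) : 1 < p ->
  (\int[mu]_(x in `[1%R, +oo[) (x `^ (- p))%:E = ((p - 1)^-1)%:E)%E.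
Proof.
move=> p1; have p10 : 0 < p - 1 by rewrite subr_gt0.
pose F (x : R) := - (p - 1)^-1 * x `^ (- (p - 1)).
have dF (x : R) : 0 < x -> is_derive x 1 F (x `^ (- p)).
  move=> x0; rewrite /F.
  have H := @is_derive1_powR R (- (p - 1)) x x0.
  have := is_deriveZ (- (p - 1)^-1) H.
  rewrite scalerA mulrNN mulVf ?gt_eqF// scale1r.
  by have -> : - (p - 1) - 1 = - p by ring.
rewrite (@ge0_continuous_FTC2y R (fun x => x `^ (- p)) F 1 0).
- by rewrite /F powR1 mulr1 -EFinB sub0r opprK.
- by move=> x _; exact: powR_ge0.
- apply: derivable_within_continuous => x; rewrite in_itv/= andbT => x1.
  by apply: derivable_powR; rewrite in_itv/= andbT (lt_le_trans ltr01).
- rewrite -[X in _ --> X](mulr0 (- (p - 1)^-1)).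
  by apply: cvgMr; exact: powR_negexp_cvgy.
- by move=> x x1; have /= [] := dF x (lt_trans ltr01 x1).
- apply: cvg_at_right_filter; apply: differentiable_continuous.
  by apply/derivable1_diffP; have /= [] := dF 1 ltr01.
- move=> x; rewrite in_itv/= andbT => x1.
  by rewrite derive1E; have /= [] := dF x (lt_trans ltr01 x1).
Qed.

(** Supplies the majorant near minus infinity for the [alpha]-th power of the kernel. *)
Lemma integrable_powR_tail (p : R) : 1 < p ->
  mu.-integrable setT
    (EFin \o (fun y => (- y) `^ (- p) * \1_(`]-oo, (- 1)]%classic) y)).
Proof.
move=> p1; apply/integrableP; split.
  apply/measurable_EFinP; apply: measurable_funM.
    by apply: (@measurableT_comp _ _ _ _ _ _ (@powR R ^~ (- p))).
  exact: measurable_indic.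
pose f (y : R) : \bar R := (y `^ (- p) * \1_(`[1, +oo[%classic) y)%:E.
have mf : measurable_fun setT f.
  apply/measurable_EFinP; apply: measurable_funM; first exact: measurable_powR.
  exact: measurable_indic.
have f0 y : (0 <= f y)%E by rewrite lee_fin mulr_ge0 ?powR_ge0.
have E1 : (\int[mu]_(y in `[0%R, +oo[) f y <= ((p - 1)^-1)%:E)%E.
  rewrite -integral_powR_itvcy// integral_mkcond [leRHS]integral_mkcond.
  apply: ge0_le_integral => //.
  - by move=> x _; rewrite patchE; case: ifPn.
  - exact/(measurable_restrictT _ (measurable_itv _))/measurable_funTS.
  - apply/(measurable_restrictT _ (measurable_itv _))/measurable_funTS.
    by apply/measurable_EFinP; exact: measurable_powR.
  - move=> x _; rewrite !patchE /f indicE.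
    by case: (x \in `[1, +oo[%classic); case: (x \in _) => //=;
      rewrite ?mulr1 ?mulr0// lee_fin powR_ge0.
apply: le_lt_trans (ltry (p - 1)^-1); apply: le_trans E1.
rewrite ge0_integration_by_substitution0// [leRHS]integral_mkcond.
apply: ge0_le_integral => //.
- apply/measurableT_comp => //; apply/measurable_EFinP; apply: measurable_funM.
    by apply: (@measurableT_comp _ _ _ _ _ _ (@powR R ^~ (- p))).
  exact: measurable_indic (measurable_itv _).
- apply/(measurable_restrictT _ (measurable_itv _))/measurable_funTS.
  by apply: (measurableT_comp mf).
- move=> x _; rewrite patchE /f !indicE /= !mem_setE !in_itv/= andbT.
  rewrite ger0_norm ?mulr_ge0 ?powR_ge0// indicE mem_setE in_itv/= lerNr.
  case: ifPn => //; rewrite -ltNge => x0.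
  by rewrite (_ : (1 <= - x) = false) ?mulr0//; apply/negbTE; rewrite -ltNge; lra.
Qed.

End PowerTail.

(** * The rescaled kernel and the upper bound of its norm *)

Section Profile.
Context {R : realType}.
Notation mu := (@lebesgue_measure R).

Lemma pospow_ge0 (x k : R) : 0 <= pospow x k.
Proof. by rewrite /pospow; case: ifP => // _; exact: powR_ge0. Qed.

Lemma pospow_maxE (x k : R) : 0 < k -> pospow x k = (Num.max x 0) `^ k.
Proof.
move=> k0; rewrite /pospow; case: ltP => // _.
by rewrite powR0// gt_eqF.
Qed.

Lemma measurable_pospow (c k : R) : 0 < k ->
  measurable_fun setT (fun y : R => pospow (c - y) k).
Proof.
move=> k0; under eq_fun do rewrite pospow_maxE//.
apply: (@measurableT_comp _ _ _ _ _ _ (@powR R ^~ k)) => //.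
by apply: measurable_maxr => //; exact: measurable_funB.
Qed.

(** A mean value bound without the factor [k]; factoring out [r] reduces it to (1 + t)^k <= 1 +
    t. *)
Lemma powR_incr_le (r x k : R) : 0 < r -> 0 <= x -> 0 < k -> k <= 1 ->
  0 <= (r + x) `^ k - r `^ k <= x * r `^ (k - 1).
Proof.
move=> r0 x0 k0 k1; apply/andP; split.
  by rewrite subr_ge0 ge0_ler_powR ?nnegrE ?(ltW k0) ?(ltW r0) ?addr_ge0 ?lerDl// ltW.
have -> : r + x = r * (1 + x / r) by field; rewrite gt_eqF.
have xr0 : 0 <= x / r by rewrite divr_ge0// ltW.
rewrite powRM ?(ltW r0) ?addr_ge0//.
have -> : r `^ (k - 1) = r `^ k / r.
  by rewrite powRB ?powRr1 ?(ltW r0)// (gt_eqF r0) implybT.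
have h : (1 + x / r) `^ k <= 1 + x / r by rewrite ler1_powR// lerDl.
have := ler_wpM2l (powR_ge0 r k) h.
rewrite mulrDr mulr1 => h2; rewrite lerBlDl (le_trans h2)//.
by rewrite lerD2l mulrCA lexx.
Qed.

Variable psi : R -> R.
Hypothesis cpsi : continuous psi.
Hypothesis psi0 : forall x, x \notin `[0, 1] -> psi x = 0.
Hypothesis int_psi0 : \int[mu]_x psi x = 0.

Let A := \int[mu]_x `|psi x|.

(** The kernel of a nodal sum of the field in the variable [y], where [s = c * y + e] and
    [k = v - 1/alpha], with the factor c^k removed. *)
Definition profile (n : nat) (k y : R) : R :=
  \sum_(i < n.+2) weight psi n i * pospow (node n i - y) k.

Lemma measurable_profile n k : 0 < k -> measurable_fun setT (profile n k).
Proof.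
move=> k0; apply: measurable_sum => i; apply: measurable_funM => //.
exact: measurable_pospow.
Qed.

Lemma sum_weight_le n (h : nat -> R) (B : R) :
  (forall i, (i < n.+2)%N -> `|h i| <= B) ->
  `|\sum_(i < n.+2) weight psi n i * h i| <= A * B.
Proof.
move=> hB; apply: le_trans (ler_norm_sum _ _ _) _.
apply: (@le_trans _ _ (\sum_(i < n.+2) `|weight psi n i| * B)).
  by apply: ler_sum => i _; rewrite normrM ler_wpM2l// hB.
rewrite -mulr_suml ler_wpM2r//; last exact: sum_norm_weight.
by apply: le_trans (hB 0%N _).
Qed.

Lemma profile_eq0 n k y : 1 <= y -> profile n k y = 0.
Proof.
move=> y1; rewrite /profile big1// => i _.
rewrite /pospow ltNge subr_le0 (le_trans (node_le1 (R:=R) (ltn_ord i)))//=.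
by rewrite mulr0.
Qed.

Lemma profile_le_mid n k y : 0 < k -> k <= 1 -> - 1 <= y ->
  `|profile n k y| <= A * 2.
Proof.
move=> k0 k1 y1; apply: (@sum_weight_le n (fun i => pospow (node n i - y) k)) => i ni.
rewrite ger0_norm ?pospow_ge0// /pospow; case: ifPn => // h.
apply: (@le_trans _ _ (2 `^ k)).
  rewrite ge0_ler_powR ?nnegrE ?(ltW k0) ?(ltW h)//.
  by have := node_le1 (R:=R) ni; lra.
by rewrite ler1_powR// ler1n.
Qed.

(** As the weights sum to 0, the common value (- y)^k can be subtracted from each term, and only
    increments of the power function remain. *)
Lemma profile_le_far n k y : 0 < k -> k <= 1 -> y <= - 1 ->
  `|profile n k y| <= A * (- y) `^ (k - 1).
Proof.
move=> k0 k1 y1.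
have -> : profile n k y =
    \sum_(i < n.+2) weight psi n i * (pospow (node n i - y) k - (- y) `^ k).
  under [RHS]eq_bigr do rewrite mulrBr.
  rewrite sumrB -mulr_suml (sum_weight cpsi psi0) int_psi0 mul0r subr0//.
apply: (@sum_weight_le n (fun i => pospow (node n i - y) k - (- y) `^ k)) => i ni.
have ny0 : 0 < - y by lra.
have x0 := @node_ge0 R n i; have x1 := node_le1 (R:=R) ni.
have /andP[h1 h2] := powR_incr_le ny0 x0 k0 k1.
rewrite /pospow (addrC (node n i)) ltr_wpDr// ger0_norm// (le_trans h2)//.
by rewrite ler_piMl ?powR_ge0.
Qed.

(** One majorant serves all [n] and [k]: a constant on [[-1, 1]], and the worst exponent [k1] on the
    left of -1, where [- y >= 1]. The condition [1 < alpha * (1 - k1)] is integrability of that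
    tail; with [k1 = Hup - 1/alpha] it amounts to [Hup < 1]. *)
Lemma integral_profile_le (alpha k1 : R) : 0 < alpha -> k1 < 1 ->
  1 < alpha * (1 - k1) ->
  exists M : R, 0 < M /\ forall n k, 0 < k -> k <= k1 ->
  (\int[mu]_y (`|profile n k y| `^ alpha)%:E <= M%:E)%E.
Proof.
move=> a0 k11 ak.
pose T y := (- y) `^ (- (alpha * (1 - k1))) * \1_(`]-oo, (- 1)]%classic) y.
pose D (y : R) := (A * 2) `^ alpha * \1_(`[(- 1), 1]%classic) y + A `^ alpha * T y.
have A0 : 0 <= A by apply: Rintegral_ge0.
have T0 y : 0 <= T y by rewrite mulr_ge0 ?powR_ge0.
have D0 y : 0 <= D y by rewrite addr_ge0 ?mulr_ge0 ?powR_ge0.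
have iD : mu.-integrable setT (EFin \o D).
  have i1 : mu.-integrable setT (EFin \o (fun y => (A * 2) `^ alpha * \1_(`[(- 1), 1]%classic) y)).
    apply: integrable_scale.
    exact: integrable_indic_itv.
  have i2 : mu.-integrable setT (EFin \o (fun y => A `^ alpha * T y)).
    by apply: integrable_scale; exact: integrable_powR_tail.
  by apply: eq_integrable (integrableD measurableT i1 i2).
exists (1 + \int[mu]_y D y); split.
  by rewrite ltr_wpDr// Rintegral_ge0.
move=> n k k0 kk1.
have k1' : k <= 1 by exact: le_trans kk1 (ltW k11).
apply: (@le_trans _ _ (\int[mu]_y (D y)%:E)%E); last first.
  by rewrite /Rintegral -[leLHS]fineK ?(integrable_fin_num measurableT iD)// lee_fin lerDr.
apply: ge0_le_integral => //.
- apply/measurable_EFinP.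
  apply: (@measurableT_comp _ _ _ _ _ _ (@powR R ^~ alpha)) => //.
  by apply: measurableT_comp => //; exact: measurable_profile.
- by case/integrableP: iD.
move=> y _; rewrite lee_fin /D.
have [y1|y1] := lerP 1 y.
  by rewrite profile_eq0// normr0 powR0 ?gt_eqF// D0.
have [ym1|ym1] := lerP (- 1) y.
  apply: (@le_trans _ _ ((A * 2) `^ alpha)).
    by rewrite ge0_ler_powR ?nnegrE ?(ltW a0) ?mulr_ge0// profile_le_mid.
  by rewrite indicE mem_set ?mulr1 ?lerDl ?mulr_ge0 ?powR_ge0//= in_itv/= ym1 ltW.
apply: (@le_trans _ _ ((A * (- y) `^ (k1 - 1)) `^ alpha)).
  rewrite ge0_ler_powR ?nnegrE ?(ltW a0) ?mulr_ge0 ?powR_ge0//.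
  apply: le_trans (profile_le_far _ k0 k1' (ltW ym1)) _.
  by rewrite ler_wpM2l// ler_powR//; lra.
have E1 : \1_(`]-oo, (- 1)]%classic) y = 1 :> R.
  by rewrite indicE mem_set//= in_itv/= ltW.
rewrite powRM ?powR_ge0// -powRrM /T E1 mulr1.
rewrite (_ : (k1 - 1) * alpha = - (alpha * (1 - k1))); last by ring.
by rewrite lerDr mulr_ge0 ?powR_ge0.
Qed.

End Profile.

(** * Truncated squares and quadratic B-splines *)

Section Spline.
Context {R : realType}.
Notation mu := (@lebesgue_measure R).

Lemma Rintegral_indic_itv (a b : R) : a <= b ->
  \int[mu]_x \1_(`[a, b]%classic) x = b - a.
Proof.
move=> ab; rewrite /Rintegral integral_indic // setIT.
transitivity (fine (b - a)%:E) => //; congr fine.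
have := @lebesgue_measure_itv R `[a, b]; rewrite /= lte_fin => E; apply: etrans E _.
case: ifPn => //; rewrite -leNgt => ba.
by have -> : a = b; [apply/eqP; rewrite eq_le ab|rewrite subrr].
Qed.

Lemma Rintegral_continuous_gt0 (f : R -> R) (x0 : R) : continuous f ->
  (forall x, 0 <= f x) -> mu.-integrable setT (EFin \o f) -> 0 < f x0 ->
  0 < \int[mu]_x f x.
Proof.
move=> cf f0 fi fx0.
have := cf x0 => /cvgrPdist_lt /(_ (f x0 / 2)).
rewrite divr_gt0// => /(_ isT) [r /= r0 hr].
apply: (@lt_le_trans _ _ (\int[mu]_x (f x0 / 2 * \1_(`[x0 - r / 2, x0 + r / 2]%classic) x))).
  rewrite RintegralZl//; last exact: integrable_indic_itv.
  by rewrite Rintegral_indic_itv ?mulr_gt0//; lra.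
apply: le_Rintegral => //.
  by apply: integrable_scale; exact: integrable_indic_itv.
move=> x _; rewrite indicE; case: (boolP (x \in _)) => [|_]; last by rewrite mulr0.
rewrite inE/= in_itv/= mulr1 => /andP[h1 h2].
have : `|f x0 - f x| < f x0 / 2.
  by apply: hr; rewrite /ball_/= ltr_norml; apply/andP; split; lra.
by rewrite ltr_norml => /andP[]; lra.
Qed.

Definition sqpos (u : R) : R := (Num.max u 0) ^+ 2.

Lemma sqposE (u : R) : sqpos u = if 0 < u then u ^+ 2 else 0.
Proof. by rewrite /sqpos; case: ltP => // _; rewrite expr0n. Qed.

Lemma continuous_sqpos (c : R) : continuous (fun x => sqpos (x - c)).
Proof.
have h : continuous (fun x => Num.max (x - c) 0).
  move=> x; apply: (@continuous_max _ _ (fun x => x - c) (fun=> 0)) => //.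
  - by apply: cvgB; [exact: cvg_id|exact: cvg_cst].
  - exact: cvg_cst.
by move=> x; apply: cvgM; exact: h.
Qed.

Definition spline_coef (i : nat) : R := nth 0 [:: 1; -3; 3; -1] i.

(* Third differences of [sqpos] are quadratic B-splines. *)
Lemma spline_ge0 (h u : R) : 0 < h ->
  0 <= \sum_(i < 4) spline_coef i * sqpos (u - i%:R * h).
Proof.
move=> h0; rewrite !big_ord_recl big_ord0 /spline_coef/= !sqposE.
rewrite /bump/= !addn0.
do 4 case: ifPn => [|]; rewrite -?leNgt => *; try nra.
Qed.

(** Left of the first knot every term vanishes; right of the last one the sum is a third difference
    of a quadratic polynomial. *)
Lemma spline_eq0 (h u : R) : 0 < h -> (u <= 0) || (3 * h <= u) ->
  \sum_(i < 4) spline_coef i * sqpos (u - i%:R * h) = 0.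
Proof.
move=> h0; rewrite !big_ord_recl big_ord0 /spline_coef/= !sqposE.
rewrite /bump/= !addn0 => /orP[?|uh].
  by rewrite !ifF; [ring|apply/negbTE; rewrite -leNgt; nra..].
have h1 : 0 < u - 0 * h by lra.
have h2 : 0 < u - 1 * h by lra.
have h3 : 0 < u - (1 + 1)%:R * h by lra.
rewrite h1 h2 h3; case: ltP => [_|h4]; first by ring.
have -> : u = 3 * h by apply/le_anti/andP; split; lra.
by ring.
Qed.

End Spline.

(** * A nonvanishing truncated quadratic moment of the wavelet *)

Section Moment.
Context {R : realType}.
Notation mu := (@lebesgue_measure R).
Lemma continuous_sumr (I : Type) (s : seq I) (f : I -> R -> R) :
  (forall i, continuous (f i)) ->
  continuous (fun x => \sum_(i <- s) f i x).
Proof.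
move=> cf; elim: s => [|i s ih].
  by under eq_fun do rewrite big_nil; move=> x; exact: cvg_cst.
under eq_fun do rewrite big_cons.
by move=> x; apply: cvgD; [exact: cf|exact: ih].
Qed.

Variable psi : R -> R.
Hypothesis cpsi : continuous psi.
Hypothesis psi0 : forall x, x \notin `[0, 1] -> psi x = 0.

(** If the moments vanished at four equally spaced knots, so would the integral of [psi] against
    their B-spline; but a narrow spline centred at a point where [psi] is nonzero sees one sign
    only. *)
Lemma exists_sqpos_moment : (exists x, psi x != 0) ->
  exists z, \int[mu]_x (psi x * sqpos (x - z)) != 0.
Proof.
move=> [x0 px0].
have := @cpsi x0 => /cvgrPdist_lt /(_ `|psi x0|).
rewrite normr_gt0 => /(_ px0) [r /= r0 hr].
have sgn x : `|x0 - x| < r -> 0 < psi x0 * psi x.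
  move=> /hr /=; case: (ltP 0 (psi x0)) => p0.
    by rewrite (ger0_norm (ltW p0)) ltr_norml => /andP[]; nra.
  have {}p0 : psi x0 < 0 by rewrite lt_neqAle px0.
  by rewrite (ltr0_norm p0) ltr_norml => /andP[]; nra.
(* The spline lives on [[p, p + 3 * h]], centred at [x0] with half-width 3r/4, hence inside the
   interval of radius [r] where [psi] keeps its sign. *)
pose h := r / 2; have h0 : 0 < h by rewrite divr_gt0.
pose p := x0 - 3 * h / 2.
pose z (i : nat) := p + i%:R * h.
pose S (x : R) : R := \sum_(i < 4) spline_coef i * sqpos (x - z i).
have SE x : S x = \sum_(i < 4) spline_coef i * sqpos ((x - p) - i%:R * h).
  by apply: eq_bigr => i _; rewrite /z opprD addrA.
have cS (i : nat) : continuous (fun x => psi x * sqpos (x - z i)).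
  by move=> x; apply: cvgM; [exact: (@cpsi)|exact: continuous_sqpos].
have iS (i : nat) :
    mu.-integrable setT (EFin \o (fun x => psi x * sqpos (x - z i))).
  by apply: compact_support_integrable => // x /psi0 ->; rewrite mul0r.
have S0 : psi x0 * \int[mu]_x (\sum_(i < 4) spline_coef i * (psi x * sqpos (x - z i))) > 0.
  rewrite -RintegralZl//; last first.
    by apply: integrable_sumr => i; exact: integrable_scale.
  apply: (@Rintegral_continuous_gt0 _ _ x0).
  - move=> x; apply: cvgM; first exact: cvg_cst.
    apply: (@continuous_sumr 'I_4 _ (fun i y => spline_coef i * (psi y * sqpos (y - z i)))).
    by move=> i y; apply: cvgM; [exact: cvg_cst|exact: cS].
  - move=> x; under eq_bigr do rewrite mulrCA.
    rewrite -mulr_sumr mulrA -/(S x) SE.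
    case: (ltP `|x0 - x| r) => [/sgn/ltW h1|h1].
      by rewrite mulr_ge0//; exact: spline_ge0.
    rewrite spline_eq0 ?mulr0//; apply/orP.
    move: h1; rewrite ler_normr => /orP[h1|h1]; [left|right];
      by rewrite /p /h; lra.
  - apply: integrable_scale.
    by apply: integrable_sumr => i; exact: integrable_scale.
  - under eq_bigr do rewrite mulrCA.
    rewrite -mulr_sumr mulrA -/(S x0) SE mulr_gt0//.
      by apply: sgn; rewrite subrr normr0.
    have -> : x0 - p = 3 * h / 2 by rewrite /p; ring.
    rewrite !big_ord_recl big_ord0 /spline_coef/= !sqposE /bump/= !addn0.
    have h1 : 0 < 3 * h / 2 - 0 * h by lra.
    have h2 : 0 < 3 * h / 2 - 1 * h by lra.
    have h3 : (0 < 3 * h / 2 - (1 + 1)%:R * h) = false by apply/negbTE; rewrite -leNgt; lra.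
    have h4 : (0 < 3 * h / 2 - (1 + (1 + 1))%:R * h) = false by apply/negbTE; rewrite -leNgt; lra.
    rewrite h1 h2 h3 h4; nra.
apply: contrapT => /forallNP nz.
have nz' i : \int[mu]_x (psi x * sqpos (x - z i)) = 0.
  by apply/eqP/negPn/negP; exact: nz.
move: S0; rewrite Rintegral_sum; last by move=> i; exact: integrable_scale.
rewrite big1 ?mulr0 ?ltxx// => i _.
by rewrite RintegralZl// nz' mulr0.
Qed.

End Moment.

(** * Lower bound for the norm of the rescaled kernel *)

Section ProfileLowerBound.
Context {R : realType}.
Notation mu := (@lebesgue_measure R).

(** The two exponents add up to 1, so by scaling the integral in [y] is the Euler beta value B(k +
    1, 2 - k) times (t - z)_+^2; only the constant still depends on [k]. *)
Definition beta_kernel (z t k y : R) : R := pospow (t - y) k * pospow (y - z) (1 - k).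

Lemma measurable_beta_kernel z t k : 0 < k < 1 ->
  measurable_fun setT (beta_kernel z t k).
Proof.
move=> /andP[k0 k1]; apply: measurable_funM; first exact: measurable_pospow.
under eq_fun do rewrite pospow_maxE ?subr_gt0//.
apply: (@measurableT_comp _ _ _ _ _ _ (@powR R ^~ (1 - k))) => //.
by apply: measurable_maxr => //; exact: measurable_funB.
Qed.

Lemma beta_kernel_ge0 z t k y : 0 <= beta_kernel z t k y.
Proof. by rewrite mulr_ge0// pospow_ge0. Qed.

Lemma integrable_beta_kernel z t k : 0 < k < 1 ->
  mu.-integrable setT (EFin \o beta_kernel z t k).
Proof.
move=> /[dup] k01 /andP[k0 k1].
apply: (le_integrable measurableT _ _
  (integrable_scale ((t - z) `^ k * (t - z) `^ (1 - k)) (integrable_indic_itv z t true false))).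
  by apply/measurable_EFinP; exact: measurable_beta_kernel.
move=> y _ /=; rewrite lee_fin ger0_norm ?beta_kernel_ge0//.
rewrite ger0_norm ?mulr_ge0 ?powR_ge0// /beta_kernel /pospow.
case: ltP => [ty|_]; last by rewrite mul0r !mulr_ge0 ?powR_ge0.
case: ltP => [yz|_]; last by rewrite mulr0 !mulr_ge0 ?powR_ge0.
rewrite indicE mem_set ?mulr1; last by rewrite /= in_itv/=; apply/andP; split; lra.
rewrite ler_pM ?powR_ge0// ge0_ler_powR ?nnegrE ?subr_ge0; lra.
Qed.

Definition beta_const (k : R) : R := \int[mu]_y beta_kernel 0 1 k y.

(** On [[1/4, 3/4]] both factors are at least 1/4, because x^p >= x for [x] and [p] in [[0, 1]]; the
    interval has length 1/2. *)
Lemma beta_const_ge k : 0 < k < 1 -> 32^-1 <= beta_const k.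
Proof.
move=> /[dup] k01 /andP[k0 k1].
apply: (@le_trans _ _ (\int[mu]_x (16^-1 * \1_(`[4^-1, 3 / 4]%classic) x))).
  rewrite RintegralZl//; last exact: integrable_indic_itv.
  by rewrite Rintegral_indic_itv; lra.
apply: le_Rintegral => //.
- by apply: integrable_scale; exact: integrable_indic_itv.
- exact: integrable_beta_kernel.
move=> x _; rewrite indicE; case: (boolP (x \in _)) => [|_]; last first.
  by rewrite mulr0 beta_kernel_ge0.
rewrite inE/= in_itv/= mulr1 => /andP[h1 h2].
rewrite /beta_kernel /pospow !ifT; [|lra..].
have -> : 16^-1 = 4^-1 * 4^-1 :> R by field.
rewrite ler_pM// ?invr_ge0//.
  by rewrite (@le_trans _ _ (1 - x))//; [lra|rewrite ger1_powR; lra].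
by rewrite subr0 (@le_trans _ _ x)// ger1_powR; lra.
Qed.

Lemma Rintegral_beta_kernel z t k : 0 < k < 1 ->
  \int[mu]_y beta_kernel z t k y = beta_const k * sqpos (t - z).
Proof.
move=> /[dup] k01 /andP[k0 k1]; rewrite sqposE; case: ltP => tz; last first.
  rewrite mulr0 (_ : \int[mu]_y _ = \int[mu]_y (0 : R)).
    by rewrite Rintegral_cst// mul0r.
  apply: eq_Rintegral => y _; rewrite /beta_kernel /pospow.
  case: ltP => ty; last by rewrite mul0r.
  by case: ltP => yz; [lra|rewrite mulr0].
rewrite (Rintegral_affine z tz); last exact: measurable_beta_kernel.
rewrite [X in _ * X](_ : _ = \int[mu]_x ((t - z) * beta_kernel 0 1 k x)).
  by rewrite RintegralZl ?/beta_const; [ring|exact: measurableT|exact: integrable_beta_kernel].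
apply: eq_Rintegral => x _; rewrite /beta_kernel.
have -> : t - ((t - z) * x + z) = (t - z) * (1 - x) by ring.
have -> : (t - z) * x + z - z = (t - z) * (x - 0) by ring.
have pM u q : pospow ((t - z) * u) q = (t - z) `^ q * pospow u q.
  rewrite /pospow pmulr_rgt0//; case: ltP => u0; last by rewrite mulr0.
  by rewrite powRM// ltW.
rewrite !pM mulrACA -powRD; last by rewrite (gt_eqF tz) implybT.
by rewrite (addrC k) subrK powRr1// ltW.
Qed.

Variable psi : R -> R.
Hypothesis cpsi : continuous psi.
Hypothesis psi0 : forall x, x \notin `[0, 1] -> psi x = 0.
Hypothesis psi_neq0 : exists x, psi x != 0.

Lemma Rintegral_profile_beta n z k : 0 < k < 1 ->
  mu.-integrable setT (EFin \o (fun y => profile psi n k y * pospow (y - z) (1 - k))) /\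
  \int[mu]_y (profile psi n k y * pospow (y - z) (1 - k)) =
  beta_const k * \sum_(i < n.+2) sqpos (node n i - z) * weight psi n i.
Proof.
move=> k01.
have E : (fun y => profile psi n k y * pospow (y - z) (1 - k)) =
    (fun y => \sum_(i < n.+2) weight psi n i * beta_kernel z (node n i) k y).
  by apply/funext => y; rewrite mulr_suml; apply: eq_bigr => i _; rewrite mulrA.
rewrite E; split.
  by apply: integrable_sumr => i; apply: integrable_scale; exact: integrable_beta_kernel.
rewrite Rintegral_sum; last first.
  by move=> i; apply: integrable_scale; exact: integrable_beta_kernel.
rewrite mulr_sumr; apply: eq_bigr => i _.
rewrite RintegralZl//; last exact: integrable_beta_kernel.
rewrite Rintegral_beta_kernel//; ring.
Qed.

(** Stands in for Hölder's inequality: an integral of |f| over a bounded set is controlled by that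
    of |f|^alpha, at an additive cost made small by [eta]. For [x > eta] the factor (x / eta)^(alpha
    - 1) is at least 1. *)
Lemma le_add_powR (eta x alpha : R) : 0 < eta -> 0 <= x -> 1 < alpha ->
  x <= eta + eta `^ (1 - alpha) * x `^ alpha.
Proof.
move=> e0 x0 a1; have [xe|ex] := lerP x eta.
  by rewrite ler_wpDr// mulr_ge0 ?powR_ge0.
rewrite ler_wpDl ?(ltW e0)//.
have xp : 0 < x by exact: lt_trans e0 ex.
have -> : x `^ alpha = x * x `^ (alpha - 1) by rewrite mulr_powRB1//; lra.
rewrite mulrCA ler_peMr//.
rewrite -(opprB alpha 1) powRN mulrC ler_pdivlMr ?powR_gt0// mul1r.
rewrite ge0_ler_powR ?nnegrE; lra.
Qed.

(** Pairing the profile with (y - z)_+^(1 - k) gives [beta_const k] times a nodal sum that tends to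
    a nonzero moment. This bounds the pairing below uniformly in [k], while [le_add_powR] bounds it
    above through the [alpha]-th power integral. *)
Lemma integral_profile_ge (alpha : R) : 1 < alpha ->
  exists m : R, 0 < m /\ \forall n \near \oo, forall k, 0 < k < 1 ->
  mu.-integrable setT (EFin \o (fun y => `|profile psi n k y| `^ alpha)) ->
  m <= \int[mu]_y (`|profile psi n k y| `^ alpha).
Proof.
move=> a1.
have [z T0] := exists_sqpos_moment cpsi psi0 psi_neq0.
set T := \int[mu]_x _ in T0.
have cv := riemann_cvg cpsi psi0 (@continuous_sqpos R z).
have z1 : z < 1.
  rewrite ltNge; apply/negP => z1; move/eqP: T0; apply.
  rewrite /T (_ : \int[mu]_y _ = \int[mu]_y (0 : R)).
    by rewrite Rintegral_cst// mul0r.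
  apply: eq_Rintegral => y _; rewrite sqposE.
  have [|/psi0 ->] := boolP (y \in `[0, 1]); last by rewrite mul0r.
  rewrite in_itv/= => /andP[y0 y1]; rewrite ifF ?mulr0//.
  by apply/negbTE; rewrite -leNgt; lra.
pose tau := `|T| / 2.
have tau0 : 0 < tau by rewrite divr_gt0// normr_gt0.
have nearS : \forall n \near \oo,
    tau <= `|\sum_(i < n.+2) sqpos (node n i - z) * weight psi n i|.
  have := cv => /cvgrPdist_lt /(_ _ tau0); apply: filterS => n.
  rewrite -/T => h; have := ler_normD (T - \sum_(i < n.+2) sqpos (node n i - z) * weight psi n i)
    (\sum_(i < n.+2) sqpos (node n i - z) * weight psi n i).
  by rewrite subrK; move: h; rewrite /tau; lra.
(* For [y < 1] the factor (y - z)_+^(1 - k) is at most [G], since [G >= 1] and [G >= 1 - z]. The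
   choice of [eta] makes the additive cost [G * eta * (1 - z)] equal to tau/64, half of the lower
   bound tau/32. *)
pose G : R := 1 + (1 - z); have G0 : 0 < G by rewrite /G; lra.
pose eta := tau / (64 * G * (1 - z)).
have eta0 : 0 < eta by rewrite divr_gt0// !mulr_gt0//; lra.
pose m := tau / (64 * G * eta `^ (1 - alpha)).
exists m; split; first by rewrite divr_gt0// !mulr_gt0// powR_gt0.
near=> n => k k01 ik; have /andP[k0 k1] := k01.
have [ib Eb] := Rintegral_profile_beta n z k01.
set I := \int[mu]_y _.
have h1 : tau / 32 <= `|\int[mu]_y (profile psi n k y * pospow (y - z) (1 - k))|.
  rewrite Eb normrM mulrC ler_pM// ?divr_ge0 ?(ltW tau0)//.
    by rewrite (le_trans (beta_const_ge k01))// ler_norm.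
  by near: n.
have h2 : `|\int[mu]_y (profile psi n k y * pospow (y - z) (1 - k))| <=
    G * eta * (1 - z) + G * eta `^ (1 - alpha) * I.
  have iG : mu.-integrable setT (EFin \o (fun y => G * eta * \1_(`[z, 1]%classic) y +
      G * eta `^ (1 - alpha) * `|profile psi n k y| `^ alpha)).
    have i1 := integrable_scale (G * eta) (integrable_indic_itv z 1 true false).
    have i2 := integrable_scale (G * eta `^ (1 - alpha)) ik.
    by apply: eq_integrable (integrableD measurableT i1 i2).
  apply: le_trans (le_normr_Rintegral measurableT ib) _.
  apply: (@le_trans _ _ (\int[mu]_y (G * eta * \1_(`[z, 1]%classic) y +
      G * eta `^ (1 - alpha) * `|profile psi n k y| `^ alpha))).
    apply: le_Rintegral => //; first exact: integrable_normr.
    move=> y _; rewrite normrM (ger0_norm (pospow_ge0 _ _)).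
    have R0 : 0 <= G * eta * \1_(`[z, 1]%classic) y +
      G * eta `^ (1 - alpha) * `|profile psi n k y| `^ alpha.
      have Ge0 : 0 <= G * eta := mulr_ge0 (ltW G0) (ltW eta0).
      have Gp : 0 <= G * eta `^ (1 - alpha) := mulr_ge0 (ltW G0) (powR_ge0 _ _).
      by apply: addr_ge0; [apply: (mulr_ge0 Ge0)|apply: (mulr_ge0 Gp); exact: powR_ge0].
    have [y1|y1] := lerP 1 y; first by apply: le_trans R0; rewrite profile_eq0// normr0 mul0r.
    rewrite [pospow _ _]/pospow; case: ltP => [zy|_]; last by rewrite mulr0.
    rewrite indicE mem_set ?mulr1; last by rewrite /= in_itv/=; apply/andP; split; lra.
    rewrite (_ : _ + _ = G * (eta + eta `^ (1 - alpha) * `|profile psi n k y| `^ alpha)); last by ring.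
    rewrite mulrC ler_pM ?powR_ge0//.
      apply: (@le_trans _ _ (G `^ (1 - k))).
        by rewrite ge0_ler_powR ?nnegrE /G; lra.
      by rewrite ler1_powR /G; lra.
    exact: le_add_powR.
  rewrite RintegralD//.
  - rewrite !RintegralZl//; last exact: integrable_indic_itv.
    by rewrite Rintegral_indic_itv// ltW.
  - by apply: integrable_scale; exact: integrable_indic_itv.
  - exact: integrable_scale.
have := le_trans h1 h2.
have -> : G * eta * (1 - z) = tau / 64.
  by rewrite /eta; field; rewrite !gt_eqF//; lra.
rewrite -lerBlDl (_ : tau / 32 - tau / 64 = tau / 64); last by field.
have Gp : 0 < 64 * G * eta `^ (1 - alpha).
  by apply: mulr_gt0; [apply: mulr_gt0|exact: powR_gt0].
by rewrite /m !ler_pdivrMr//; lra.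
Unshelve. all: by end_near. Qed.

End ProfileLowerBound.

(** * Linearity of the stable integral *)

Section StableIntegralLinear.
Context {d : measure_display} {Omega : measurableType d} {R : realType}.
Variables (P : probability Omega R) (Z : R -> {RV P >-> R}) (alpha : R).
Hypothesis alpha1 : 1 <= alpha.
Notation mu := (@lebesgue_measure R).

Lemma ge0_squeeze_cvge0 (u v : nat -> \bar R) :
  (forall n, 0 <= u n <= v n)%E -> v @ \oo --> 0%E -> u @ \oo --> 0%E.
Proof.
move=> uv; apply: (@squeeze_cvge _ _ _ _ (cst 0%E)); [exact: nearW|exact: cvg_cst].
Qed.

Lemma Lnorm_scale (c : R) (f : R -> R) : measurable_fun setT f ->
  ('N[mu]_(alpha%:E)[EFin \o (fun x => (c * f x)%R)] =
   `|c|%:E * 'N[mu]_(alpha%:E)[EFin \o f])%E.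
Proof.
move=> mf; rewrite unlock /Lnorm.
under eq_integral do rewrite /= normrM powRM// EFinM.
rewrite ge0_integralZl//; last first.
  apply/measurable_EFinP.
  apply: (@measurableT_comp _ _ _ _ _ _ (@powR R ^~ alpha)) => //.
  exact: measurableT_comp.
rewrite poweRM ?lee_fin ?powR_ge0 ?integral_ge0//.
by rewrite poweR_EFin -powRrM mulfV ?powRr1// gt_eqF// (lt_le_trans ltr01).
Qed.

Lemma measurable_step_fun (s : step) : measurable_fun setT (@step_fun R s).
Proof.
by apply: measurable_sum => p; apply: measurable_funM.
Qed.

Lemma measurable_step_integral (s : step) :
  measurable_fun setT (step_integral (fun t => Z t : Omega -> R) s).
Proof.
apply: measurable_sum => p; apply: measurable_funM => //.
exact: measurable_funB.
Qed.

Lemma measurable_ge_norm (e : R) (Y : Omega -> R) : measurable_fun setT Y ->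
  measurable [set w | e <= `|Y w|].
Proof.
move=> mY; rewrite -[X in measurable X]setTI.
by apply: measurable_fun_le => //; exact: measurableT_comp.
Qed.

Lemma cvg_in_probability_lin (c : R) (Y Y' : nat -> Omega -> R) (Y0 Y0' : Omega -> R) :
  (forall n, measurable_fun setT (Y n)) -> (forall n, measurable_fun setT (Y' n)) ->
  measurable_fun setT Y0 -> measurable_fun setT Y0' ->
  cvg_in_probability P Y Y0 -> cvg_in_probability P Y' Y0' ->
  cvg_in_probability P (fun n w => c * Y n w + Y' n w) (fun w => c * Y0 w + Y0' w).
Proof.
move=> mY mY' mY0 mY0' cY cY' e e0.
pose e1 := e / (2 * (`|c| + 1)).
have c10 : 0 < `|c| + 1 by rewrite ltr_wpDl.
have e10 : 0 < e1 by rewrite divr_gt0// mulr_gt0.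
have e20 : 0 < e / 2 by rewrite divr_gt0.
have H : forall n, measurable [set w | e1 <= `|Y n w - Y0 w|].
  by move=> n; apply: measurable_ge_norm; exact: measurable_funB.
have H' : forall n, measurable [set w | e / 2 <= `|Y' n w - Y0' w|].
  by move=> n; apply: measurable_ge_norm; exact: measurable_funB.
apply: (@ge0_squeeze_cvge0 _ (fun n => P [set w | (e1 <= `|Y n w - Y0 w|)%R] +
    P [set w | (e / 2 <= `|Y' n w - Y0' w|)%R])%E); last first.
  rewrite -[X in _ --> X]add0e.
  by apply: cvgeD => //; [exact: cY|exact: cY'].
move=> n; rewrite measure_ge0/=.
apply: le_trans (measureU2 _ (H n) (H' n)).
apply: le_measure; rewrite ?inE.
- by apply: measurable_ge_norm; apply: measurable_funB;
    apply: measurable_funD => //; apply: measurable_funM.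
- exact: measurableU.
move=> w /= ew; apply/orP; rewrite -implyNb; apply/implyP; rewrite -ltNge => h.
have E : c * Y n w + Y' n w - (c * Y0 w + Y0' w) =
  c * (Y n w - Y0 w) + (Y' n w - Y0' w) by ring.
have h1 := ler_normD (c * (Y n w - Y0 w)) (Y' n w - Y0' w).
rewrite -E normrM in h1.
have h2 : `|c| * `|Y n w - Y0 w| <= e / 2.
  apply: (@le_trans _ _ (`|c| * e1)); first by rewrite ler_wpM2l// ltW.
  by rewrite /e1 mulrA ler_pdivrMr ?mulr_gt0//; nra.
lra.
Qed.

Lemma is_stable_integral0 :
  is_stable_integral P alpha (fun t => Z t : Omega -> R) (fun=> 0) (fun=> 0).
Proof.
split=> //.
  by rewrite inE; apply/andP; split; rewrite inE//=; exact: finite_norm_cst0.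
exists (fun=> [::]); split=> //.
- rewrite (_ : (fun _ => _) = cst 0%E); first exact: cvg_cst.
  apply/funext => n; rewrite -(@Lnorm0 _ _ _ mu alpha%:E) ?gt_eqF//.
    by apply: eq_Lnorm => x; rewrite /= /step_fun big_nil subrr.
  by rewrite lte_fin (lt_le_trans ltr01).
- move=> e e0; rewrite (_ : (fun _ => _) = cst 0%E); first exact: cvg_cst.
  apply/funext => n; rewrite (_ : [set _ | _] = set0) ?measure0//.
  apply/seteqP; split=> w //=.
  by rewrite /step_integral big_nil subrr normr0 leNgt e0.
Qed.

(** Concatenating step sequences adds both the step functions and their integrals; Minkowski's
    inequality handles the norms, a splitting of the event the convergence in probability. *)
Lemma is_stable_integral_lin (c : R) (f g : R -> R) (I J : Omega -> R) :
  is_stable_integral P alpha (fun t => Z t : Omega -> R) f I ->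
  is_stable_integral P alpha (fun t => Z t : Omega -> R) g J ->
  is_stable_integral P alpha (fun t => Z t : Omega -> R) (fun x => c * f x + g x)
    (fun w => c * I w + J w).
Proof.
move=> [Lf mI [s [ws cs ps]]] [Lg mJ [t [wt ct pt]]].
have a1 : (1 <= alpha%:E)%E by rewrite lee_fin.
have mf : measurable_fun setT f by move: Lf; rewrite inE => /andP[/[!inE]].
have mg : measurable_fun setT g by move: Lg; rewrite inE => /andP[/[!inE]].
split.
- have L1 : (fun x => c * f x) \in Lfun mu alpha%:E.
    have := @Lfun_scale _ _ _ mu f c alpha alpha1 Lf.
    by rewrite (_ : c \o* f = (fun x => c * f x))//; apply/funext => x /=; rewrite mulrC.
  exact: (proj2 (Lfun_addr_closed mu a1) _ _ L1 Lg).
- by apply: measurable_funD => //; exact: measurable_funM.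
pose r n : step := [seq (c * p.1, p.2) | p <- s n] ++ t n.
exists r; split.
- move=> n; rewrite /wf_step all_cat all_map; apply/andP; split; last exact: wt.
  exact: ws.
- apply: (@ge0_squeeze_cvge0 _ (fun n => `|c|%:E * 'N[mu]_(alpha%:E)[EFin \o (f \- step_fun (s n))%R]
      + 'N[mu]_(alpha%:E)[EFin \o (g \- step_fun (t n))%R])%E); last first.
    rewrite (_ : 0%E = `|c|%:E * 0 + 0)%E; last by rewrite mule0 adde0.
    by apply: cvgeD; [by rewrite mule0|exact: cvgeZl|].
  move=> n; rewrite Lnorm_ge0/=.
  have ms := measurable_step_fun (s n). have mt := measurable_step_fun (t n).
  rewrite -Lnorm_scale; last exact: measurable_funB.
  apply: le_trans (minkowski_EFin mu _ _ alpha1).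
  + rewrite le_eqVlt; apply/orP; left; apply/eqP; apply: eq_Lnorm => x /=.
    congr EFin; rewrite /step_fun big_cat big_map/=.
    under eq_bigr do rewrite -mulrA.
    by rewrite -mulr_sumr; ring.
  + by apply: measurable_funM => //; exact: measurable_funB.
  + exact: measurable_funB.
have := cvg_in_probability_lin c (fun n => measurable_step_integral (s n))
  (fun n => measurable_step_integral (t n)) mI mJ ps pt.
congr cvg_in_probability; apply/funext => n; apply/funext => w.
rewrite /step_integral big_cat big_map/=.
under [in RHS]eq_bigr do rewrite -mulrA.
by rewrite -mulr_sumr.
Qed.

Lemma is_stable_integral_sum (T : Type) (s : seq T) (c : T -> R)
    (f : T -> R -> R) (I : T -> Omega -> R) :
  (forall i, is_stable_integral P alpha (fun t => Z t : Omega -> R) (f i) (I i)) ->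
  is_stable_integral P alpha (fun t => Z t : Omega -> R)
    (fun x => \sum_(i <- s) c i * f i x) (fun w => \sum_(i <- s) c i * I i w).
Proof.
move=> h; elim: s => [|i s ih].
  rewrite (_ : (fun x => _) = (fun=> 0)); last by apply/funext => x; rewrite big_nil.
  rewrite (_ : (fun w => _) = (fun=> 0)); last by apply/funext => x; rewrite big_nil.
  exact: is_stable_integral0.
have -> : (fun x => \sum_(j <- i :: s) c j * f j x) =
  (fun x => c i * f i x + \sum_(j <- s) c j * f j x).
  by apply/funext => x; rewrite big_cons.
have -> : (fun x => \sum_(j <- i :: s) c j * I j x) =
  (fun x => c i * I i x + \sum_(j <- s) c j * I j x).
  by apply/funext => x; rewrite big_cons.
exact: is_stable_integral_lin.
Qed.

End StableIntegralLinear.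

(** * Characteristic functions of averages of the field at a fixed exponent *)

Section CharacteristicFunction.
Context {d : measure_display} {Omega : measurableType d} {R : realType}.
Notation mu := (@lebesgue_measure R).

Lemma regular_path_continuous (alpha : R) (x : R -> R -> R) (g : R -> R) :
  regular_path alpha x -> continuous g ->
  (forall t, alpha^-1 < g t < 1) -> continuous (fun t => x t (g t)).
Proof.
move=> [cx _] cg gr t0.
have gamma : (t, g t) @[t --> t0] -->
    within [set uv : R * R | alpha^-1 < uv.2 < 1] (nbhs (t0, g t0)).
  have h : (t, g t) @[t --> t0] --> (t0, g t0).
    by apply: (@cvg_pair _ _ _ (nbhs t0) (nbhs t0) (nbhs (g t0)) _ _ _ id g); [exact: cvg_id|exact: cg].
  move=> U /= UA; have H : nbhs t0 ((fun t => (t, g t)) @^-1`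
      (fun y => alpha^-1 < y.2 < 1 -> U y)) := h _ UA.
  apply: filterS H => t /=.
  by apply; exact: gr.
have := (proj1 (subspace_continuousP _ _) cx) (t0, g t0) (gr t0).
move=> H; exact: (cvg_comp _ _ gamma H).
Qed.

Variables (P : probability Omega R) (Z : R -> {RV P >-> R}) (alpha : R).
Hypothesis alpha1 : 1 < alpha.
Hypothesis hZnorm : SaS_normalized P alpha (fun t => Z t : Omega -> R).
Variable X : R -> R -> Omega -> R.
Hypothesis hX : SaS_field P alpha (fun t => Z t : Omega -> R) X.
Variable psi : R -> R.
Hypothesis cpsi : continuous psi.
Hypothesis psi0 : forall x, x \notin `[0, 1] -> psi x = 0.
Hypothesis int_psi0 : \int[mu]_x psi x = 0.
Hypothesis psi_neq0 : exists x, psi x != 0.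

Let alpha0 : 0 < alpha. Proof. exact: lt_trans alpha1. Qed.

(** With [c] the mesh 2^(-j) and [e] the left end of a dyadic interval, this is the wavelet
    coefficient whose exponent is frozen at [v]. *)
Definition field_average (c e v : R) (w : Omega) : R :=
  \int[mu]_x (psi x * X (c * x + e) v w).

Definition nodal_sum (c e v : R) (n : nat) (w : Omega) : R :=
  \sum_(i < n.+2) weight psi n i * X (c * node n i + e) v w.

Lemma continuous_field (v : R) w : alpha^-1 < v < 1 -> continuous (fun t => X t v w).
Proof.
move=> hv; apply: (regular_path_continuous (g := fun=> v) (proj2 hX w)) => //.
by move=> t; exact: cvg_cst.
Qed.

Let continuous_field_affine (c e v : R) w : alpha^-1 < v < 1 ->
  continuous (fun x : R => X (c * x + e) v w).
Proof.
move=> hv x; apply: (@continuous_comp _ _ _ (fun x : R => c * x + e)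
  (fun t => X t v w)); last exact: (@continuous_field v w hv).
apply: cvgD; last exact: cvg_cst.
by apply: cvgM; [exact: cvg_cst|exact: cvg_id].
Qed.

Lemma nodal_sum_cvg c e v w : alpha^-1 < v < 1 ->
  nodal_sum c e v n w @[n --> \oo] --> field_average c e v w.
Proof.
move=> hv; rewrite (_ : (fun n => _) =
  (fun n => \sum_(i < n.+2) X (c * node n i + e) v w * weight psi n i)).
  exact: (riemann_cvg cpsi psi0 (@continuous_field_affine c e v w hv)).
by apply/funext => n; apply: eq_bigr => i _; rewrite mulrC.
Qed.

Lemma is_stable_integral_nodal_sum c e v n : alpha^-1 < v < 1 ->
  is_stable_integral P alpha (fun t => Z t : Omega -> R)
    (fun s => \sum_(i < n.+2) weight psi n i * lmsm_kernel alpha (c * node n i + e) v s)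
    (nodal_sum c e v n).
Proof.
move=> hv; apply: (@is_stable_integral_sum _ _ _ P Z alpha (ltW alpha1) 'I_n.+2 _
  (fun i => weight psi n i)
  (fun i => lmsm_kernel alpha (c * node n i + e) v)
  (fun i => X (c * node n i + e) v)) => i.
exact: (proj1 hX).
Qed.

Lemma measurable_nodal_sum c e v n : alpha^-1 < v < 1 ->
  measurable_fun setT (nodal_sum c e v n).
Proof. by move=> /(@is_stable_integral_nodal_sum c e _ n) []. Qed.

Lemma measurable_field_average c e v : alpha^-1 < v < 1 ->
  measurable_fun setT (field_average c e v).
Proof.
move=> hv; apply: measurable_fun_cvg (fun n => measurable_nodal_sum c e n hv) _.
by move=> w _; exact: nodal_sum_cvg.
Qed.

(* The terms in [pospow (- s)] of the kernels cancel because the weights sum to 0. *)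
Lemma nodal_kernelE c e v n y : 0 < c ->
  \sum_(i < n.+2) weight psi n i * lmsm_kernel alpha (c * node n i + e) v (c * y + e) =
  c `^ (v - alpha^-1) * profile psi n (v - alpha^-1) y.
Proof.
move=> c0; rewrite /lmsm_kernel; under eq_bigr do rewrite mulrBr.
rewrite sumrB -mulr_suml (sum_weight cpsi psi0) int_psi0 mul0r subr0.
rewrite /profile mulr_sumr; apply: eq_bigr => i _; rewrite [RHS]mulrCA; congr (_ * _).
have -> : c * node n i + e - (c * y + e) = c * (node n i - y) by ring.
rewrite /pospow pmulr_rgt0//; case: ltP => u0; last by rewrite mulr0.
by rewrite powRM// ltW.
Qed.

(** Self-similarity of index [v]: the Jacobian [c] and the power c^((v - 1/alpha) alpha) of the
    kernel combine to c^(v alpha). *)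
Lemma integral_nodal_kernel c e v n : 0 < c -> alpha^-1 < v < 1 ->
  mu.-integrable setT
    (EFin \o (fun y => `|profile psi n (v - alpha^-1) y| `^ alpha)) ->
  \int[mu]_s (`|\sum_(i < n.+2) weight psi n i *
    lmsm_kernel alpha (c * node n i + e) v s| `^ alpha) =
  (c `^ v) `^ alpha *
    \int[mu]_y (`|profile psi n (v - alpha^-1) y| `^ alpha).
Proof.
move=> c0 /andP[v0 v1] ip.
rewrite (Rintegral_affine e c0); last first.
  apply: (@measurableT_comp _ _ _ _ _ _ (@powR R ^~ alpha)) => //.
  apply: measurableT_comp => //; apply: measurable_sum => i.
  apply: measurable_funM => //; apply: measurable_funB.
    by apply: measurable_pospow; lra.
  under eq_fun do rewrite -sub0r.
  by apply: measurable_pospow; lra.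
under eq_Rintegral do rewrite nodal_kernelE// normrM ger0_norm ?powR_ge0// powRM ?powR_ge0//.
rewrite RintegralZl// mulrA; congr (_ * _).
rewrite -!powRrM.
have -> : v * alpha = 1 + (v - alpha^-1) * alpha by field; rewrite gt_eqF.
by rewrite powRD ?(gt_eqF c0) ?implybT// powRr1// ltW.
Qed.

(** The cosine means of the nodal sums are explicit and converge by dominated convergence. The norm
    bounds are uniform in the exponent and hold for all large [n], which is enough to pass to the
    limit. *)
Lemma charfun_field_average (Hup : R) : Hup < 1 -> alpha^-1 < Hup ->
  exists m M : R, [/\ 0 < m, 0 < M &
  forall c e v, 0 < c -> alpha^-1 < v -> v <= Hup -> forall xi : R,
    expR (- (M * (`|xi| * c `^ v) `^ alpha)) <=
      \int[P]_w cos (xi * field_average c e v w) <=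
    expR (- (m * (`|xi| * c `^ v) `^ alpha))].
Proof.
move=> hup1 hup0.
have k11 : Hup - alpha^-1 < 1.
  have : 0 < alpha^-1 by rewrite invr_gt0.
  by lra.
have ak : 1 < alpha * (1 - (Hup - alpha^-1)).
  rewrite (_ : alpha * _ = alpha * (1 - Hup) + 1); last by field; rewrite gt_eqF.
  by rewrite ltrDr mulr_gt0//; lra.
have [M [M0 hM]] := integral_profile_le cpsi psi0 int_psi0 alpha0 k11 ak.
have [m [m0 hm]] := integral_profile_ge cpsi psi0 psi_neq0 alpha1.
exists m, M; split=> // c e v c0 v0 v1 xi.
have hv : alpha^-1 < v < 1 by rewrite v0 (le_lt_trans v1).
pose k := v - alpha^-1.
have ai : 0 < alpha^-1 by rewrite invr_gt0.
have k0 : 0 < k by rewrite /k; lra.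
have kk : k <= Hup - alpha^-1 by rewrite /k; lra.
have ip n : mu.-integrable setT (EFin \o (fun y => `|profile psi n k y| `^ alpha)).
  apply/integrableP; split.
    apply/measurable_EFinP.
    apply: (@measurableT_comp _ _ _ _ _ _ (@powR R ^~ alpha)) => //.
    by apply: measurableT_comp => //; exact: measurable_profile.
  under eq_integral do rewrite /= ger0_norm ?powR_ge0//.
  exact: le_lt_trans (hM n k k0 kk) (ltry _).
have cosE n : \int[P]_w cos (xi * nodal_sum c e v n w) =
    expR (- ((`|xi| * c `^ v) `^ alpha * \int[mu]_y (`|profile psi n k y| `^ alpha))).
  have [h _] := hZnorm (is_stable_integral_nodal_sum c e n hv) xi.
  rewrite [LHS]/Rintegral; move: h; rewrite unlock => -> /=; congr (expR (- _)).
  by rewrite integral_nodal_kernel// powRM ?powR_ge0// mulrA.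
have cv : \int[P]_w cos (xi * nodal_sum c e v n w) @[n --> \oo] -->
    \int[P]_w cos (xi * field_average c e v w).
  apply: (@Rdominated_convergence _ _ _ P
    (fun n w => cos (xi * nodal_sum c e v n w))
    (fun w => cos (xi * field_average c e v w)) (fun=> 1)).
  - move=> n; apply: measurableT_comp.
      exact: continuous_measurable_fun (@continuous_cos R).
    by apply: measurable_funM => //; exact: measurable_nodal_sum.
  - apply: measurableT_comp.
      exact: continuous_measurable_fun (@continuous_cos R).
    by apply: measurable_funM => //; exact: measurable_field_average.
  - move=> w; apply: continuous_cvg; first exact: continuous_cos.
    by apply: cvgMr; exact: nodal_sum_cvg.
  - exact: finite_measure_integrable_cst.
  - by move=> n w; exact: cos_max.
have q0 : 0 <= (`|xi| * c `^ v) `^ alpha by exact: powR_ge0.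
apply/andP; split.
  apply: (cvgr_to_ge cv); apply: nearW => n; rewrite cosE ler_expR lerN2 mulrC ler_wpM2r//.
  have := hM n k k0 kk; rewrite -lee_fin; apply: le_trans.
  by rewrite /Rintegral fineK//; exact: (integrable_fin_num measurableT (ip n)).
apply: (cvgr_to_le cv); move: hm; apply: filterS => n hn.
rewrite cosE ler_expR lerN2 [leLHS]mulrC ler_wpM2l// hn//.
by rewrite k0 (le_lt_trans kk).
Qed.

End CharacteristicFunction.

(** * Fractional moments from a lower bound of the characteristic function *)

Section Moments.
Context {R : realType}.

Lemma geometric_partial_le (a z : R) n : 0 <= a -> 0 <= z < 1 ->
  \sum_(i < n) a * z ^+ i <= a / (1 - z).
Proof.
move=> a0 /andP[z0 z1].
have z1' : z != 1 by rewrite lt_eqF.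
have := congr1 (fun f => f n) (geometric_seriesE a z1').
rewrite /series/= big_mkord => ->.
rewrite ler_wpM2r ?invr_ge0 ?subr_ge0 ?(ltW z1)//.
by rewrite ler_piMr// lerBlDr lerDl exprn_ge0.
Qed.

Lemma powR2_lt1 (s : R) : s < 0 -> 2 `^ s < 1.
Proof. by move=> s0; rewrite /powR gt_eqF// expR_lt1 nmulr_rlt0// ln_gt0// ltr1n. Qed.

Lemma powR_half_expr (a : R) n : (2^-1 ^+ n) `^ a = (2 `^ (- a)) ^+ n.
Proof.
have half : 2^-1 `^ a = 2 `^ (- a) :> R.
  by rewrite -(powR_inv1 (ler0n R 2)) -powRrM mulN1r.
elim: n => [|n ih]; first by rewrite !expr0 powR1.
by rewrite !exprS powRM ?exprn_ge0 ?invr_ge0// ih half.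
Qed.

Lemma ler_cos (x y : R) : 0 <= x -> x <= y -> y <= pi -> cos y <= cos x.
Proof.
move=> x0 xy yp; rewrite leNgt ltr_cos ?in_itv/= -?leNgt ?x0 ?yp ?(le_trans x0 xy)//.
by rewrite (le_trans xy yp).
Qed.

Lemma cos1_lt1 : cos 1 < 1 :> R.
Proof.
rewrite -[ltRHS]cos0 ltr_cos ?in_itv/= ?lexx ?ler01 ?pi_ge0//.
by rewrite (le_trans _ (@pi_ge2 R))// ler1n.
Qed.

(** Brings a large value into [[1, 2[], where 1 - cos is bounded away from 0. *)
Lemma exists_dyadic_scale (x : R) : 1 <= x -> exists n : nat, 1 <= 2^-1 ^+ n * x < 2.
Proof.
move=> x1.
have ex : exists n : nat, x < 2 ^+ n.
  exists (Num.truncn x).+1; apply: lt_trans (truncnS_gt x) _.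
  by rewrite -natrX ltr_nat ltn_expl.
case: (ex_minnP ex) => -[|n] hn hmin.
  by move: hn; rewrite expr0 ltNge x1.
exists n; have n2 : 0 < 2 ^+ n :> R by rewrite exprn_gt0.
rewrite exprVn mulrC ler_pdivlMr// ltr_pdivrMr// mul1r -exprS hn andbT leNgt.
by apply/negP => /hmin; rewrite ltnn.
Qed.

Context {d : measure_display} {Omega : measurableType d}.
Variable P : probability Omega R.

Lemma measurable_cosM (xi : R) (S : Omega -> R) : measurable_fun setT S ->
  measurable_fun setT (fun w => cos (xi * S w)).
Proof.
move=> mS; apply: measurableT_comp; last exact: measurable_funM.
exact: continuous_measurable_fun (@continuous_cos R).
Qed.

Lemma integrable_bounded (M : R) (f : Omega -> R) : measurable_fun setT f ->
  (forall w, `|f w| <= M) -> P.-integrable setT (EFin \o f).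
Proof.
move=> mf fM.
apply: (le_integrable measurableT) (finite_measure_integrable_cst P M measurableT).
  exact/measurable_EFinP.
by move=> w _ /=; rewrite lee_fin (le_trans (fM w))// ler_norm.
Qed.

Lemma integrable_cosM (xi : R) (S : Omega -> R) : measurable_fun setT S ->
  P.-integrable setT (EFin \o (fun w => cos (xi * S w))).
Proof.
move=> mS; apply: (@integrable_bounded 1); first exact: measurable_cosM.
by move=> w; exact: cos_max.
Qed.

Variables (alpha : R).
Hypothesis alpha1 : 1 < alpha.

(** |S|^beta is dominated by 1 + K times the sum over [n] of 2^(n beta) (1 - cos(2^(-n) S)): the
    term at the dyadic scale of [S] suffices. Its means are of order 2^(n (beta - alpha)), summable
    since [beta < alpha]. *)
Lemma moment_le (beta M : R) : 0 < beta -> beta < alpha -> 0 < M ->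
  exists C : R, 0 < C /\ forall S : Omega -> R, measurable_fun setT S ->
  (forall xi, expR (- (M * `|xi| `^ alpha)) <= \int[P]_w cos (xi * S w)) ->
  (\int[P]_w (`|S w| `^ beta)%:E <= C%:E)%E.
Proof.
move=> b0 ba M0.
pose c0 : R := 1 - cos 1; have c00 : 0 < c0 by rewrite subr_gt0 cos1_lt1.
(* For [t] in [[1, 2[], t^beta <= 2^beta, and 1 - cos t >= 1 - cos 1 because 2 <= pi; the quotient
   of the two bounds is [K]. *)
pose K := 2 `^ beta / c0; have K0 : 0 < K by rewrite divr_gt0// powR_gt0.
pose z : R := 2 `^ (beta - alpha).
have z01 : 0 <= z < 1.
  by rewrite powR_ge0/= powR2_lt1// subr_lt0.
have C0 : 0 < K * M / (1 - z).
  by apply: divr_gt0; [exact: mulr_gt0|rewrite subr_gt0; case/andP: z01].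
exists (1 + K * M / (1 - z)); split; first by rewrite ltr_wpDl.
move=> S mS hS.
have Kn0 n : 0 <= K * (2 `^ beta) ^+ n.
  by apply: mulr_ge0; [exact: ltW|rewrite exprn_ge0// powR_ge0].
pose u n w : R := K * (2 `^ beta) ^+ n * (1 - cos (2^-1 ^+ n * S w)).
have u0 n w : 0 <= u n w.
  by rewrite mulr_ge0 ?Kn0// subr_ge0 cos_le1.
have mu_ n : measurable_fun setT (u n).
  by apply: measurable_funM => //; apply: measurable_funB => //; exact: measurable_cosM.
have mser : measurable_fun setT (fun w => \sum_(n <oo) (u n w)%:E)%E.
  apply: ge0_emeasurable_sum => [n w _ _|n _]; first by rewrite lee_fin.
  exact/measurable_EFinP.
apply: (@le_trans _ _ (\int[P]_w (1 + \sum_(n <oo) (u n w)%:E))%E).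
  apply: ge0_le_integral => //.
  - apply/measurable_EFinP; apply: (@measurableT_comp _ _ _ _ _ _ (@powR R ^~ beta)) => //.
    exact: measurableT_comp.
  - exact: emeasurable_funD.
  - move=> w _; have [S1|S1] := lerP `|S w| 1.
      apply: (@le_trans _ _ 1%E).
        have : `|S w| `^ beta <= 1 `^ beta by rewrite ge0_ler_powR ?nnegrE ?(ltW b0).
        by rewrite powR1 lee_fin.
      by rewrite leeDl// nneseries_ge0// => n _ _; rewrite lee_fin.
    have [n /andP[n1 n2]] := exists_dyadic_scale (ltW S1).
    apply: (@le_trans _ _ (u n w)%:E).
      have E : `|S w| = 2 ^+ n * (2^-1 ^+ n * `|S w|).
        by rewrite mulrA -exprMn mulfV ?expr1n ?mul1r// pnatr_eq0.
      have t0 : 0 <= 2^-1 ^+ n * `|S w| by rewrite (le_trans ler01 n1).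
      rewrite lee_fin; have -> : `|S w| `^ beta = (2 ^+ n) `^ beta * (2^-1 ^+ n * `|S w|) `^ beta.
        by rewrite [in LHS]E powRM// exprn_ge0.
      have -> : (2 ^+ n) `^ beta = (2 `^ beta) ^+ n :> R.
        by rewrite -!powR_mulrn ?powR_ge0// -!powRrM mulrC.
      rewrite /u mulrAC [leLHS]mulrC ler_wpM2r ?exprn_ge0 ?powR_ge0//.
      apply: (@le_trans _ _ (2 `^ beta)).
        rewrite ge0_ler_powR ?nnegrE ?(ltW b0) ?(ltW n2)//.
      rewrite /K -mulrA ler_peMr ?powR_ge0// ler_pdivlMl// mulr1.
      rewrite /c0 lerD2l lerN2 -[leLHS]cos_norm normrM ger0_norm ?exprn_ge0 ?invr_ge0//.
      by apply: ler_cos => //; rewrite (le_trans (ltW n2))// pi_ge2.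
    apply: (@le_trans _ _ (\sum_(0 <= k < n.+1) (u k w)%:E)%E).
      rewrite big_nat_recr//= leeDr// sume_ge0// => k _; by rewrite lee_fin.
    apply: (le_trans (nneseries_lim_ge n.+1 _)); first by move=> k _ _; rewrite lee_fin.
    by rewrite leeDr.
rewrite ge0_integralD//; last first.
  by move=> w _; rewrite nneseries_ge0// => n _ _; rewrite lee_fin.
have I1 : (\int[P]__ 1 = 1)%E.
  by apply: etrans (integral_cst P measurableT 1) _; rewrite mul1e; exact: probability_setT.
rewrite I1 EFinD leeD2l//.
rewrite integral_nneseries//; last 2 first.
- by move=> n; exact/measurable_EFinP.
- by move=> n w _; rewrite lee_fin.
apply: lime_le.
  by apply: is_cvg_nneseries => n _ _; apply: integral_ge0 => w _; rewrite lee_fin.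
apply: nearW => N.
apply: (@le_trans _ _ (\sum_(0 <= i < N) (K * M * z ^+ i)%:E)%E); last first.
  rewrite sumEFin lee_fin big_mkord.
  by apply: geometric_partial_le => //; rewrite mulr_ge0// ltW.
apply: lee_sum => n _.
have iu : P.-integrable setT (EFin \o u n).
  apply: (@integrable_bounded (K * (2 `^ beta) ^+ n * 2)) => // w.
  rewrite ger0_norm// ler_wpM2l ?Kn0//.
  by have := cos_geN1 (2^-1 ^+ n * S w); lra.
rewrite -[leLHS]fineK; last exact: (integrable_fin_num measurableT iu).
rewrite lee_fin -/(Rintegral P setT (u n)) /u RintegralZl//; last first.
  apply: (@integrable_bounded 2).
    by apply: measurable_funB => //; exact: measurable_cosM.
  move=> w; rewrite ler_norml.
  by have := cos_geN1 (2^-1 ^+ n * S w); have := cos_le1 (2^-1 ^+ n * S w); lra.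
rewrite RintegralB//; [|exact: finite_measure_integrable_cst|exact: integrable_cosM].
rewrite (_ : \int[P]__ 1 = 1); last by rewrite /Rintegral I1.
(* The mean of 1 - cos is at most 1 - exp(- t) <= t with t = M 2^(-n alpha). *)
have h := hS (2^-1 ^+ n); have h2 := expR_ge1Dx (- (M * `|2^-1 ^+ n| `^ alpha)).
have -> : K * M * z ^+ n = K * (2 `^ beta) ^+ n * (M * `|2^-1 ^+ n| `^ alpha).
  rewrite ger0_norm ?exprn_ge0//.
  rewrite powR_half_expr.
  rewrite /z powRD ?pnatr_eq0 ?implybT// exprMn; clearbody K; ring.
rewrite ler_wpM2l ?Kn0//.
by lra.
Qed.

End Moments.

(** * Small ball estimate from decay of the characteristic function *)

Section SmallBall.
Context {d : measure_display} {Omega : measurableType d} {R : realType}.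
Variable P : probability Omega R.
Variable alpha : R.
Hypothesis alpha1 : 1 < alpha.

Lemma cosM_cos (x y : R) : cos x * cos y = 2^-1 * (cos (x - y) + cos (x + y)).
Proof. by rewrite cosB cosD; field. Qed.

Lemma Rintegral_probability_cst1 : \int[P]__ (1 : R) = 1.
Proof.
rewrite /Rintegral (_ : (\int[P]__ 1 = 1)%E)//.
by apply: etrans (integral_cst P measurableT 1) _; rewrite mul1e; exact: probability_setT.
Qed.

Lemma Rintegral_cos_le1 (xi : R) (S : Omega -> R) : measurable_fun setT S ->
  \int[P]_w cos (xi * S w) <= 1.
Proof.
move=> mS; rewrite -Rintegral_probability_cst1; apply: le_Rintegral => //.
- exact: integrable_cosM.
- exact: finite_measure_integrable_cst.
Qed.

(* The second moment of the average of [cos (N i S)], [i < N], is O(1/N) because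
   the characteristic function of [S] is O(1/N) outside [-N, N]; this average is
   bounded away from 0 when [S] is small. *)
Lemma small_ball_le (m : R) : 0 < m ->
  exists C : R, 0 < C /\ forall S : Omega -> R, measurable_fun setT S ->
  (forall xi, \int[P]_w cos (xi * S w) <= expR (- (m * `|xi| `^ alpha))) ->
  forall N : nat, (0 < N)%N ->
  (P [set w | (`|S w| <= (2 * N%:R ^+ 2)^-1)%R] <= (C / N%:R)%:E)%E.
Proof.
move=> m0.
(* If |S| <= 1/(2 N^2), all the arguments [N i S] with [i < N] stay within 1/2 of 0, so each cosine
   is at least [q]. *)
pose q : R := cos 2^-1.
have q0 : 0 < q.
  apply: cos_gt0_pihalf; have := @pihalf_ge1 R; set p := pi / 2 => h.
  by apply/andP; split; lra.
exists ((1 + m^-1) / q ^+ 2); split.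
  by apply: divr_gt0; [rewrite addr_gt0 ?invr_gt0|rewrite exprn_gt0].
move=> S mS hS N N0.
have NR0 : 0 < N%:R :> R by rewrite ltr0n.
have NR1 : 1 <= N%:R :> R by rewrite ler1n.
pose a (i : nat) : R := N%:R * i%:R.
pose Y w := \sum_(i < N) cos (a i * S w).
(* From exp(- t) <= 1/t with t = m |x|^alpha, where |x|^alpha >= |x| >= N. *)
have far (x : R) : N%:R <= `|x| -> \int[P]_w cos (x * S w) <= (m * N%:R)^-1.
  move=> Nx; apply: le_trans (hS x) _.
  rewrite expRN lef_pV2 ?posrE ?expR_gt0 ?mulr_gt0//.
  apply: le_trans (expR_ge1Dx _); rewrite ler_wpDl// ler_wpM2l ?(ltW m0)//.
  exact: le_trans Nx (le1r_powR (le_trans NR1 Nx) (ltW alpha1)).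
have iterm (i j : nat) : P.-integrable setT
    (EFin \o (fun w => cos (a i * S w) * cos (a j * S w))).
  apply: (@integrable_bounded _ _ _ P 1).
    by apply: measurable_funM; exact: measurable_cosM.
  by move=> w; rewrite normrM mulr_ile1 ?cos_max.
have term (i j : nat) : \int[P]_w (cos (a i * S w) * cos (a j * S w)) =
    2^-1 * (\int[P]_w cos ((a i - a j) * S w) + \int[P]_w cos ((a i + a j) * S w)).
  under eq_Rintegral do rewrite cosM_cos -mulrBl -mulrDl.
  rewrite RintegralZl//; last first.
    apply: eq_integrable (integrableD measurableT (integrable_cosM P (a i - a j) mS)
      (integrable_cosM P (a i + a j) mS)) => //.
  by rewrite RintegralD//; exact: integrable_cosM.
have diag (i : nat) : \int[P]_w (cos (a i * S w) * cos (a i * S w)) <= 1.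
  rewrite term; have := Rintegral_cos_le1 (a i - a i) mS.
  by have := Rintegral_cos_le1 (a i + a i) mS; lra.
have offdiag (i j : nat) : i != j ->
    \int[P]_w (cos (a i * S w) * cos (a j * S w)) <= (m * N%:R)^-1.
  move=> ij; rewrite term.
  have h1 : N%:R <= `|a i - a j|.
    rewrite /a -mulrBr normrM (ger0_norm (ler0n _ _)) ler_peMr//.
    case: (ltngtP i j) ij => // ij _; [rewrite distrC|];
      rewrite -natrB ?(ltnW ij)// ger0_norm// ler1n subn_gt0//.
  have h2 : N%:R <= `|a i + a j|.
    rewrite /a -mulrDr normrM (ger0_norm (ler0n _ _)) ler_peMr//.
    rewrite -natrD ger0_norm// ler1n addn_gt0.
    by case: i j ij {h1} => [|i] [|j].
  by have := far _ h1; have := far _ h2; lra.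
have YE w : Y w ^+ 2 = \sum_(i < N) \sum_(j < N) cos (a i * S w) * cos (a j * S w).
  by rewrite expr2 /Y mulr_suml; apply: eq_bigr => i _; rewrite mulr_sumr.
have iY : P.-integrable setT (EFin \o (fun w => Y w ^+ 2)).
  have := integrable_sumr (index_enum 'I_N) (fun i : 'I_N =>
    integrable_sumr (index_enum 'I_N) (fun j : 'I_N => iterm i j)).
  by apply: eq_integrable => // w _ /=; rewrite YE.
have EY : \int[P]_w (Y w ^+ 2) <= N%:R * (1 + m^-1).
  under eq_Rintegral do rewrite YE.
  rewrite Rintegral_sum; last by move=> i; exact: integrable_sumr.
  under eq_bigr do (rewrite Rintegral_sum; last by move=> j; exact: iterm).
  (* Each row has one diagonal entry, at most 1, and [N - 1] others, at most 1/(m N) each. *)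
  apply: (@le_trans _ _ (\sum_(i < N) (1 + m^-1))); last first.
    by rewrite sumr_const card_ord mulr_natl.
  apply: ler_sum => i _; rewrite (bigD1 i)//= lerD//.
  apply: (@le_trans _ _ (\sum_(j < N) (m * N%:R)^-1)).
    rewrite [leRHS](bigD1 i)//= ler_wpDl ?invr_ge0 ?mulr_ge0 ?(ltW m0)//.
    by apply: ler_sum => j ji; apply: offdiag; rewrite eq_sym.
  rewrite sumr_const card_ord -mulr_natr le_eqVlt; apply/orP; left; apply/eqP.
  by field; rewrite !gt_eqF.
set B := [set w | _].
have mB : measurable B.
  rewrite -[B]setTI; apply: measurable_fun_le => //; exact: measurableT_comp.
have PB : P B = (\int[P]_w \1_B w)%:E.
  rewrite /Rintegral integral_indic// setIT fineK//; exact: fin_num_measure.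
have iB : P.-integrable setT (EFin \o \1_B).
  apply: (@integrable_bounded _ _ _ P 1); first exact: measurable_indic.
  by move=> w; rewrite ger0_norm// indicE; case: (_ \in _).
rewrite PB lee_fin.
have NQ : 0 < N%:R ^+ 2 * q ^+ 2 by rewrite mulr_gt0 ?exprn_gt0.
have h : \int[P]_w ((N%:R ^+ 2 * q ^+ 2) * \1_B w) <= \int[P]_w (Y w ^+ 2).
  apply: le_Rintegral => //; first exact: integrable_scale.
  move=> w _; rewrite indicE; case: (boolP (w \in B)) => [|_]; last first.
    by rewrite mulr0 sqr_ge0.
  rewrite inE /B/= mulr1 => Sw; rewrite -exprMn.
  have hY : N%:R * q <= Y w.
    rewrite (_ : N%:R * q = \sum_(i < N) q); last by rewrite sumr_const card_ord mulr_natl.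
    apply: ler_sum => i _; rewrite /q -[leRHS]cos_norm.
    apply: ler_cos => //; last by rewrite (le_trans _ (@pi_ge2 R))//; lra.
    rewrite normrM /a ger0_norm ?mulr_ge0//.
    have iN : i%:R <= N%:R :> R by rewrite ler_nat ltnW.
    apply: (@le_trans _ _ (N%:R * N%:R * (2 * N%:R ^+ 2)^-1)).
      by rewrite ler_pM// ?mulr_ge0// ler_pM2l.
    by rewrite le_eqVlt; apply/orP; left; apply/eqP; field; rewrite gt_eqF.
  have Nq0 : 0 <= N%:R * q by rewrite mulr_ge0 ?(ltW q0).
  by rewrite lerXn2r ?nnegrE ?(le_trans Nq0 hY).
rewrite RintegralZl// in h.
rewrite -(ler_pM2l NQ); apply: le_trans h _; apply: le_trans EY _.
by rewrite le_eqVlt; apply/orP; left; apply/eqP; field; rewrite !gt_eqF.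
Qed.

End SmallBall.

(** * Almost sure convergence from geometrically small means *)

Section AlmostSureConvergence.
Context {d : measure_display} {Omega : measurableType d} {R : realType}.
Variable P : probability Omega R.

(** The sum of all [W j] has mean at most C/(1 - q), so it is almost surely finite and its terms
    tend to 0. *)
Lemma ae_cvg0_of_geometric_mean (W : nat -> Omega -> R) (C q : R) :
  (forall j, measurable_fun setT (W j)) -> (forall j w, 0 <= W j w) ->
  0 <= C -> 0 <= q < 1 ->
  (forall j, (\int[P]_w (W j w)%:E <= (C * q ^+ j)%:E)%E) ->
  \forall w \ae P, W j w @[j --> \oo] --> 0.
Proof.
move=> mW W0 C0 q01 hW.
have mWE j : measurable_fun setT (fun w => (W j w)%:E) by exact/measurable_EFinP.
have S0 w : (0 <= \sum_(j <oo) (W j w)%:E)%E.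
  by apply: nneseries_ge0 => j _ _; rewrite lee_fin.
have iS : P.-integrable setT (fun w => \sum_(j <oo) (W j w)%:E)%E.
  apply/integrableP; split.
    by apply: ge0_emeasurable_sum => [j w _ _|j _] //; rewrite lee_fin.
  under eq_integral do rewrite gee0_abs//.
  rewrite integral_nneseries//; last by move=> j w _; rewrite lee_fin.
  apply: (@le_lt_trans _ _ (C / (1 - q))%:E); last exact: ltry.
  apply: lime_le.
    by apply: is_cvg_nneseries => n _ _; apply: integral_ge0 => w _; rewrite lee_fin.
  apply: nearW => n; apply: (@le_trans _ _ (\sum_(0 <= i < n) (C * q ^+ i)%:E)%E).
    by apply: lee_sum => i _; exact: hW.
  by rewrite sumEFin lee_fin big_mkord; exact: geometric_partial_le.
have := integrable_ae measurableT iS; apply: filterS => w /(_ I) fS.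
apply: cvg_series_cvg_0; apply: nondecreasing_is_cvgn.
  by apply: nondecreasing_series => n _ _.
exists (fine (\sum_(j <oo) (W j w)%:E)%E) => _ [n _ <-].
rewrite -lee_fin fineK// /series/= -sumEFin.
by apply: nneseries_lim_ge => j _ _; rewrite lee_fin.
Qed.

End AlmostSureConvergence.

(** * Dyadic intervals contained in a given interval *)

Section DyadicCounting.
Context {R : realType}.

(** An explicit list for [nu]: the indices go from ceil(a / c) to floor(b / c) - 1, and [truncn]
    yields the empty list when the difference is negative. *)
Definition grid (a b c : R) : seq int :=
  let k0 := Num.ceil (a / c) in
  let n := Num.truncn ((Num.floor (b / c) - k0)%:~R : R) in
  [seq k0 + i%:Z | i <- iota 0 n].

Lemma grid_uniq a b c : uniq (grid a b c).
Proof. by rewrite map_inj_uniq ?iota_uniq// => i j /addrI []. Qed.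

Lemma mem_grid (a b c : R) (k : int) : 0 < c ->
  (k \in grid a b c) = (a <= k%:~R * c) && ((k + 1)%:~R * c <= b).
Proof.
move=> c0; rewrite -(ler_pdivrMr _ _ c0) -(ler_pdivlMr _ _ c0) -ceil_le_int -floor_ge_int.
rewrite /grid; set k0 := Num.ceil _; set k1 := Num.floor _.
apply/mapP/andP => [[i]|[h0 h1]].
  rewrite mem_iota/= add0n => hi ->; split; first by rewrite lerDl.
  have : (i.+1 <= Num.truncn ((k1 - k0)%:~R : R))%N by [].
  rewrite truncn_gt_nat => h2.
  have : (i.+1%:Z)%:~R <= (k1 - k0)%:~R :> R by rewrite -pmulrn.
  by rewrite ler_int; lia.
exists `|k - k0|%N; last by rewrite gez0_abs ?subr_ge0//; ring.
rewrite mem_iota/= add0n truncn_gt_nat.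
have -> : `|k - k0|%N.+1%:R = (`|k - k0|%N.+1%:Z)%:~R :> R by rewrite -pmulrn.
by rewrite ler_int; lia.
Qed.

Lemma size_grid_ge (a b c : R) : 0 < c -> (b - a) / c - 2 <= (size (grid a b c))%:R.
Proof.
move=> c0; rewrite size_map size_iota.
set k0 := Num.ceil _; set k1 := Num.floor _.
have /andP[h1 _] := ceil_itv (a / c); have /andP[_ h2] := floor_itv (b / c).
rewrite -/k0 -/k1 in h1 h2.
rewrite intrB in h1; rewrite intrD in h2.
apply: (@le_trans _ _ ((k1 - k0)%:~R)).
  by rewrite intrB mulrBl; lra.
have [k01|k01] := lerP k0 k1.
  have : (0 <= k1 - k0)%R by rewrite subr_ge0.
  by case: (k1 - k0)%R => // n _; rewrite -pmulrn natrK.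
by rewrite (le_trans _ (ler0n _ _))// lerz0 subr_le0 ltW.
Qed.

Lemma size_grid_le (a b c : R) : 0 < c -> a <= b ->
  (size (grid a b c))%:R <= (b - a) / c.
Proof.
move=> c0 ab; rewrite size_map size_iota.
set k0 := Num.ceil _; set k1 := Num.floor _.
have [k01|k01] := lerP k0 k1.
  apply: (@le_trans _ _ ((k1 - k0)%:~R)).
    by rewrite truncn_le ler0z subr_ge0.
  rewrite intrB mulrBl lerB//; [exact: floor_le|exact: ceil_ge].
have -> : Num.truncn ((k1 - k0)%:~R : R) = 0%N.
  by apply/truncn0Pn; rewrite -ltNge ltrz1; lia.
by rewrite divr_ge0 ?subr_ge0// ltW.
Qed.

Lemma nu_grid (a b : R) (j : int) : nu `[a, b] j = [set` grid a b (2 ^ (- j))].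
Proof.
have c0 : 0 < 2 ^ (- j) :> R by rewrite exprz_gt0.
apply/seteqP; split=> k /=; rewrite mem_grid//.
  move=> h; have kk : k%:~R * 2 ^ (- j) <= (k + 1)%:~R * 2 ^ (- j) :> R.
    by rewrite ler_pM2r// ler_int lerDl.
  have := h (k%:~R * 2 ^ (- j)); have := h ((k + 1)%:~R * 2 ^ (- j)).
  rewrite /= !in_itv/= !lexx kk => /(_ isT)/andP[_ ->] /(_ isT)/andP[-> _]//.
move=> /andP[h1 h2] x /=; rewrite !in_itv/= => /andP[x1 x2].
by rewrite (le_trans h1 x1) (le_trans x2 h2).
Qed.

Lemma V_stat_grid (beta : R) (psi y : R -> R) (a b : R) (j : int) :
  V_stat beta psi y `[a, b] j =
  (size (grid a b (2 ^ (- j))))%:R^-1 *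
  \sum_(k <- grid a b (2 ^ (- j))) `|wavelet_coeff psi y j k| `^ beta.
Proof.
rewrite /V_stat nu_grid -fsbig_seq ?grid_uniq//; congr (_%:R^-1 * _).
set s := grid _ _ _.
have -> : [set` s] = [set` [fset x in s]%fset].
  by apply/seteqP; split=> x /=; rewrite inE.
by rewrite set_fsetK card_fseq undup_id// grid_uniq.
Qed.

End DyadicCounting.

(** * Wavelet coefficients of continuous paths *)

Section WaveletCoefficients.
Context {R : realType}.
Notation mu := (@lebesgue_measure R).
Variable psi : R -> R.
Hypothesis cpsi : continuous psi.
Hypothesis psi0 : forall x, x \notin `[0, 1] -> psi x = 0.

Lemma wavelet_coeffE (y : R -> R) (j k : int) : continuous y ->
  wavelet_coeff psi y j k =
  \int[mu]_x (psi x * y (2 ^ (- j) * x + k%:~R * 2 ^ (- j))).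
Proof.
move=> cy; have c0 : 0 < 2 ^ (- j) :> R by rewrite exprz_gt0.
have c1 : 2 ^ j * 2 ^ (- j) = 1 :> R by rewrite -expfzDr ?pnatr_eq0// subrr expr0z.
rewrite /wavelet_coeff (Rintegral_affine (k%:~R * 2 ^ (- j)) c0); last first.
  apply: measurable_funM; first exact: continuous_measurable_fun.
  apply: measurableT_comp; first exact: continuous_measurable_fun.
  by apply: measurable_funB => //; exact: measurable_funM.
rewrite mulrA c1 mul1r; apply: eq_Rintegral => x _; rewrite mulrC.
rewrite mulrDr mulrA c1 mul1r mulrCA c1 mulr1 addrK //.
Qed.

Lemma wavelet_coeff_dist_le (y1 y2 : R -> R) (j k : int) (B : R) :
  continuous y1 -> continuous y2 ->
  (forall t, t \in `[k%:~R * 2 ^ (- j), (k + 1)%:~R * 2 ^ (- j)] ->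
    `|y1 t - y2 t| <= B) ->
  `|wavelet_coeff psi y1 j k - wavelet_coeff psi y2 j k| <=
    \int[mu]_x `|psi x| * B.
Proof.
move=> cy1 cy2 hB; have c0 : 0 < 2 ^ (- j) :> R by rewrite exprz_gt0.
have cS (y : R -> R) : continuous y ->
    continuous (fun x : R => y (2 ^ (- j) * x + k%:~R * 2 ^ (- j))).
  move=> cy x; apply: (@continuous_comp _ _ _ (fun x : R => 2 ^ (- j) * x + k%:~R * 2 ^ (- j)) y).
    apply: cvgD; last exact: cvg_cst.
    by apply: cvgM; [exact: cvg_cst|exact: cvg_id].
  exact: cy.
have iS (y : R -> R) : continuous y -> mu.-integrable setT
    (EFin \o (fun x => psi x * y (2 ^ (- j) * x + k%:~R * 2 ^ (- j)))).
  move=> cy; apply: compact_support_integrable.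
    by move=> x; apply: cvgM; [exact: (@cpsi x)|exact: cS].
  by move=> x /psi0 ->; rewrite mul0r.
have ipsi := compact_support_integrable cpsi psi0.
rewrite !wavelet_coeffE// -RintegralB//; [|exact: iS..].
apply: le_trans (le_normr_Rintegral _ _) _ => //.
  by apply: eq_integrable (integrableB measurableT (iS _ cy1) (iS _ cy2)).
rewrite -RintegralZr//; last exact: integrable_normr.
apply: le_Rintegral => //.
- apply: integrable_normr.
  by apply: eq_integrable (integrableB measurableT (iS _ cy1) (iS _ cy2)).
- have := integrable_scale B (integrable_normr ipsi).
  by apply: eq_integrable => // x _ /=; rewrite mulrC.
move=> x _; rewrite -mulrBr normrM.
have [x01|/psi0 ->] := boolP (x \in `[0, 1]); last by rewrite normr0 !mul0r.
rewrite ler_wpM2l// hB//; move: x01; rewrite !in_itv/= => /andP[x0 x1].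
rewrite lerDr mulr_ge0 ?(ltW c0)//= intrD mulrDl addrC lerD2l mul1r.
by rewrite ler_piMr ?(ltW c0).
Qed.

End WaveletCoefficients.

(** * Means of finite averages, and the dyadic mesh *)

Section Averages.
Context {d : measure_display} {Omega : measurableType d} {R : realType}.
Variable P : probability Omega R.

Lemma integral_average_le (T : eqType) (s : seq T) (f : T -> Omega -> R) (B : R) :
  0 <= B -> (forall k, measurable_fun setT (f k)) -> (forall k w, 0 <= f k w) ->
  (forall k, k \in s -> (\int[P]_w (f k w)%:E <= B%:E)%E) ->
  (\int[P]_w ((size s)%:R^-1 * \sum_(k <- s) f k w)%:E <= B%:E)%E.
Proof.
move=> B0 mf f0 fB; have mfE k : measurable_fun setT (fun w => (f k w)%:E).
  exact/measurable_EFinP.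
under eq_integral do rewrite EFinM -sumEFin.
rewrite ge0_integralZl//; last 2 first.
- by apply: emeasurable_sum => k; exact: mfE.
- by move=> w _; apply: sume_ge0 => k _; rewrite lee_fin.
rewrite ge0_integral_sum//; last by move=> k w _; rewrite lee_fin.
apply: (@le_trans _ _ ((size s)%:R^-1%:E * (\sum_(k <- s) B%:E))%E).
  apply: lee_wpmul2l; first by rewrite lee_fin invr_ge0.
  by rewrite big_seq [leRHS]big_seq; exact: lee_sum.
rewrite sumEFin big_const_seq count_predT iter_addr addr0 -EFinM lee_fin.
(* On an empty list the average is 0, by [0^-1 = 0]. *)
rewrite -[B *+ _]mulr_natl mulrA; have [->|n0] := posnP (size s); first by rewrite invr0 !mul0r.
by rewrite mulVf ?mul1r// pnatr_eq0 -lt0n.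
Qed.

Definition mesh (j : nat) : R := 2 ^ (- j%:Z).

Lemma mesh_gt0 j : 0 < mesh j.
Proof. by rewrite exprz_gt0. Qed.

Lemma mesh_powR j (x : R) : mesh j `^ x = (2 `^ (- x)) ^+ j.
Proof. by rewrite -powR_half_expr /mesh exprVn -exprnN. Qed.

Lemma mesh_le1 j : mesh j <= 1.
Proof. by rewrite /mesh -exprnN -exprVn exprn_ile1 ?invr_ge0// invf_le1// ler1n. Qed.

Lemma ler_mesh_powR j (x y : R) : x <= y -> mesh j `^ y <= mesh j `^ x.
Proof. by move=> xy; rewrite ger_powR// mesh_gt0 mesh_le1. Qed.

End Averages.

(** * Almost sure bounds for averages of frozen coefficients *)

Section StochasticBounds.
Context {d : measure_display} {Omega : measurableType d} {R : realType}.
Notation mu := (@lebesgue_measure R).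
Variables (P : probability Omega R) (Z : R -> {RV P >-> R}) (alpha : R).
Hypothesis alpha1 : 1 < alpha.
Hypothesis hZnorm : SaS_normalized P alpha (fun t => Z t : Omega -> R).
Variable X : R -> R -> Omega -> R.
Hypothesis hX : SaS_field P alpha (fun t => Z t : Omega -> R) X.
Variable psi : R -> R.
Hypothesis cpsi : continuous psi.
Hypothesis psi0 : forall x, x \notin `[0, 1] -> psi x = 0.
Hypothesis int_psi0 : \int[mu]_x psi x = 0.
Hypothesis psi_neq0 : exists x, psi x != 0.
Variables (H : R -> R) (Hlow Hup : R).
Hypothesis hHlow : alpha^-1 < Hlow.
Hypothesis hHup : Hup < 1.
Hypothesis hHrange : forall t, H t \in `[Hlow, Hup].

Definition frozen_coeff (j : nat) (k : int) (w : Omega) : R :=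
  field_average X psi (mesh j) (k%:~R * mesh j) (H (k%:~R * mesh j)) w.

Notation v j k := (H (k%:~R * mesh j)).

Let v_low j k : alpha^-1 < v j k.
Proof. by have := hHrange (k%:~R * mesh j); rewrite in_itv/= => /andP[h _]; exact: lt_le_trans hHlow h. Qed.

Let v_up j k : v j k <= Hup.
Proof. by have := hHrange (k%:~R * mesh j); rewrite in_itv/= => /andP[]. Qed.

Let measurable_frozen j k : measurable_fun setT (frozen_coeff j k).
Proof.
apply: (measurable_field_average alpha1 hX cpsi psi0).
by rewrite v_low (le_lt_trans (v_up j k)).
Qed.

Definition normalized_coeff j k w := (mesh j `^ v j k)^-1 * frozen_coeff j k w.

Let measurable_normalized j k : measurable_fun setT (normalized_coeff j k).
Proof. exact: measurable_funM. Qed.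

Lemma charfun_normalized_coeff : exists m M : R, [/\ 0 < m, 0 < M &
  forall j k xi,
    expR (- (M * `|xi| `^ alpha)) <= \int[P]_w cos (xi * normalized_coeff j k w) <=
    expR (- (m * `|xi| `^ alpha))].
Proof.
have hup0 : alpha^-1 < Hup by exact: lt_le_trans (v_low 0 0) (v_up 0 0).
have [m [M [m0 M0 h]]] :=
  charfun_field_average alpha1 hZnorm hX cpsi psi0 int_psi0 psi_neq0 hHup hup0.
exists m, M; split=> // j k xi.
have p0 : 0 < mesh j `^ v j k by rewrite powR_gt0// mesh_gt0.
have := h (mesh j) (k%:~R * mesh j) _ (@mesh_gt0 R j) (v_low j k) (v_up j k)
  (xi * (mesh j `^ v j k)^-1).
rewrite normrM (gtr0_norm (x := _^-1)) ?invr_gt0// mulfVK ?gt_eqF//.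
by under eq_Rintegral do rewrite -mulrA.
Qed.

(** In terms of the normalized coefficient the prefactor becomes a power of the mesh with exponent
    beta (v - h) + beta eps >= beta eps, so the mean is at most C 2^(-j beta eps). *)
Lemma frozen_upper (beta eps : R) (s : nat -> seq int) (h : nat -> R) :
  0 < beta -> beta < alpha -> 0 < eps ->
  (forall j k, k \in s j -> h j <= v j k) ->
  \forall w \ae P,
    (size (s j))%:R^-1 * \sum_(k <- s j)
      mesh j `^ (- (beta * (h j - eps))) * `|frozen_coeff j k w| `^ beta
    @[j --> \oo] --> 0.
Proof.
move=> b0 ba e0 hs.
have [m [M [m0 M0 hc]]] := charfun_normalized_coeff.
have [C [C0 hC]] := moment_le P b0 ba M0.
pose q : R := 2 `^ (- (beta * eps)).
apply: (@ae_cvg0_of_geometric_mean _ _ _ P _ C q).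
- move=> j; apply: measurable_funM => //; apply: measurable_sum => k.
  apply: measurable_funM => //.
  apply: (@measurableT_comp _ _ _ _ _ _ (@powR R ^~ beta)) => //.
  exact: measurableT_comp.
- move=> j w; rewrite mulr_ge0 ?invr_ge0// sumr_ge0// => k _.
  by rewrite mulr_ge0 ?powR_ge0.
- exact: ltW.
- by rewrite powR_ge0/= powR2_lt1// oppr_lt0 mulr_gt0.
move=> j; apply: integral_average_le.
- by rewrite mulr_ge0 ?exprn_ge0 ?powR_ge0 ?(ltW C0).
- move=> k; apply: measurable_funM => //.
  apply: (@measurableT_comp _ _ _ _ _ _ (@powR R ^~ beta)) => //.
  exact: measurableT_comp.
- by move=> k w; rewrite mulr_ge0 ?powR_ge0.
move=> k ks.
have p0 : 0 < mesh j `^ v j k by rewrite powR_gt0// mesh_gt0.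
have E w : mesh j `^ (- (beta * (h j - eps))) * `|frozen_coeff j k w| `^ beta =
  mesh j `^ (beta * (v j k - h j) + beta * eps) * `|normalized_coeff j k w| `^ beta.
  have -> : `|frozen_coeff j k w| = mesh j `^ v j k * `|normalized_coeff j k w|.
    by rewrite /normalized_coeff normrM gtr0_norm ?invr_gt0// mulrA mulfV ?mul1r// gt_eqF.
  rewrite powRM ?(ltW p0)// mulrA -powRrM -powRD ?(gt_eqF (@mesh_gt0 R j)) ?implybT//.
  by congr (_ `^ _ * _); ring.
under eq_integral do rewrite E EFinM.
rewrite ge0_integralZl//; last 2 first.
- apply/measurable_EFinP.
  apply: (@measurableT_comp _ _ _ _ _ _ (@powR R ^~ beta)) => //.
  exact: measurableT_comp.
- by rewrite lee_fin powR_ge0.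
have hS := hC _ (measurable_normalized j k) (fun xi => proj1 (andP (hc j k xi))).
apply: (@le_trans _ _ ((mesh j `^ (beta * eps))%:E * C%:E)%E).
  apply: lee_pmul hS.
  - by rewrite lee_fin powR_ge0.
  - by apply: integral_ge0 => w _; rewrite lee_fin powR_ge0.
  rewrite lee_fin ler_mesh_powR// lerDr mulr_ge0 ?(ltW b0)//.
  by rewrite subr_ge0 hs.
by rewrite -EFinM lee_fin mesh_powR mulrC.
Qed.

(** Bounds the proportion of exceptionally small coefficients: each is exceptional with probability
    O(2^(-j eps)), by the small ball estimate with [N] of order 2^(j eps). *)
Lemma frozen_lower (eps : R) (s : nat -> seq int) : 0 < eps ->
  \forall w \ae P,
    (size (s j))%:R^-1 * \sum_(k <- s j)
      \1_[set w | `|frozen_coeff j k w| <= mesh j `^ (v j k + 2 * eps) / 8] w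
    @[j --> \oo] --> (0 : R).
Proof.
move=> e0.
have [m [M [m0 M0 hc]]] := charfun_normalized_coeff.
have [C [C0 hC]] := small_ball_le P alpha1 m0.
pose q : R := 2 `^ (- eps).
have mB j k : measurable
    [set w | `|frozen_coeff j k w| <= mesh j `^ (v j k + 2 * eps) / 8].
  rewrite -[X in measurable X]setTI; apply: measurable_fun_le => //.
  exact: measurableT_comp.
apply: (@ae_cvg0_of_geometric_mean _ _ _ P _ C q).
- move=> j; apply: measurable_funM => //; apply: measurable_sum => k.
  exact: measurable_indic.
- by move=> j w; rewrite mulr_ge0 ?invr_ge0// sumr_ge0.
- exact: ltW.
- by rewrite powR_ge0/= powR2_lt1// oppr_lt0.
move=> j; apply: integral_average_le => //.
- by rewrite mulr_ge0 ?exprn_ge0 ?powR_ge0 ?(ltW C0).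
- by move=> k; exact: measurable_indic.
move=> k ks; rewrite integral_indic// setIT.
have p0 : 0 < mesh j `^ v j k by rewrite powR_gt0// mesh_gt0.
(* [N] lies between [u] and [2 * u], so 1/(2 N^2) is at least 1/(8 u^2), which is the threshold:
   mesh^(2 eps)/8. *)
pose u : R := mesh j `^ (- eps).
have u1 : 1 <= u by rewrite /u -(powRr0 (mesh j)) ler_mesh_powR// oppr_le0 ltW.
pose N := (Num.truncn u).+1.
have uN : u < N%:R by exact: truncnS_gt.
have Nu : N%:R <= 2 * u.
  have : (Num.truncn u)%:R <= u by rewrite truncn_le (le_trans ler01).
  by rewrite /N -natr1; lra.
have u0 : 0 < u by exact: lt_le_trans u1.
have N0 : 0 < N%:R :> R by exact: lt_trans uN.
have hS := hC _ (measurable_normalized j k) (fun xi => proj2 (andP (hc j k xi))) N isT.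
apply: (@le_trans _ _ (C / N%:R)%:E); last first.
  rewrite lee_fin ler_wpM2l ?(ltW C0)//.
  have -> : q ^+ j = u^-1 by rewrite /u /q -mesh_powR -powRN opprK.
  by rewrite lef_pV2 ?posrE// ltW.
apply: le_trans hS; apply: le_measure; rewrite ?inE//.
  rewrite -[X in measurable X]setTI; apply: measurable_fun_le => //.
  exact: measurableT_comp.
move=> w /= hw; rewrite /normalized_coeff normrM gtr0_norm ?invr_gt0//.
rewrite ler_pdivrMl//; apply: le_trans hw _.
rewrite powRD ?(gt_eqF (@mesh_gt0 R j)) ?implybT// -mulrA ler_wpM2l ?(ltW p0)//.
have -> : mesh j `^ (2 * eps) = u^-1 ^+ 2.
  rewrite /u -powRN opprK mulrC powRrM powR_mulrn ?powR_ge0//.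
rewrite -[leRHS]mul1r ler_pdivlMr ?mulr_gt0 ?exprn_gt0//.
rewrite (_ : _ / 8 * _ = (N%:R / (2 * u)) ^+ 2); last by field; rewrite gt_eqF.
by rewrite expr_le1 ?divr_ge0 ?mulr_ge0 ?(ltW u0)// ler_pdivrMr ?mulr_gt0// mul1r.
Qed.

End StochasticBounds.

(** * From two-sided power bounds to the logarithmic ratio *)

Section LogLimit.
Context {R : realType}.

Lemma ln_mesh j : ln (mesh j : R) = - (j%:R * ln 2).
Proof. by rewrite /mesh -exprnN -exprVn lnXn ?invr_gt0// lnV ?posrE// mulNrn mulr_natl. Qed.

(** Constant factors move the ratio by O(1/j) only; half of the tolerance goes to them and half to
    the exponent. *)
Lemma log2_cvg (beta : R) (V h : nat -> R) : 0 < beta ->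
  (forall eps, 0 < eps -> exists c C, [/\ 0 < c, 0 < C & \forall j \near \oo,
    c * mesh j `^ (beta * (h j + eps)) <= V j <= C * mesh j `^ (beta * (h j - eps))]) ->
  (fun j => `|log2 (V j) / (- j%:R * beta) - h j|) @ \oo --> (0 : R).
Proof.
move=> b0 hV; apply/cvgr0Pnorm_le => e e0.
have [c [C [c0 C0 near_cC]]] := hV _ (divr_gt0 e0 (ltr0n R 2)).
have ln20 : 0 < ln 2 :> R by rewrite ln_gt0// ltr1n.
pose D : R := `|ln c| + `|ln C|.
near=> j; rewrite normr_id.
have /andP[h1 h2] : c * mesh j `^ (beta * (h j + e / 2)) <= V j <=
    C * mesh j `^ (beta * (h j - e / 2)) by near: j.
have j0 : 0 < j%:R :> R.
  rewrite ltr0n; near: j; exact: nbhs_infty_gt.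
have hD : D / (beta * ln 2 * (e / 2)) <= j%:R by near: j; exact: nbhs_infty_ger.
have p1 (x : R) : 0 < mesh j `^ x by rewrite powR_gt0// mesh_gt0.
have V0 : 0 < V j by apply: lt_le_trans h1; exact: mulr_gt0.
have l1 := h1; rewrite -ler_ln ?posrE ?mulr_gt0// lnM ?posrE// ln_powR ln_mesh in l1.
have l2 := h2; rewrite -ler_ln ?posrE ?mulr_gt0// lnM ?posrE// ln_powR ln_mesh in l2.
have d0 : 0 < beta * ln 2 * (e / 2) by rewrite !mulr_gt0// invr_gt0.
rewrite ler_pdivrMr// in hD.
have q0 : 0 < j%:R * beta * ln 2 by rewrite !mulr_gt0.
have -> : log2 (V j) / (- j%:R * beta) - h j =
   (- ln (V j) - h j * (j%:R * beta * ln 2)) / (j%:R * beta * ln 2).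
  by rewrite /log2; field; rewrite !gt_eqF.
rewrite normrM (gtr0_norm (x := _^-1)) ?invr_gt0// ler_pdivrMr//.
have n1 := ler_norm (- ln c); have n2 := ler_norm (ln C).
rewrite normrN in n1.
have n3 : 0 <= `|ln c| by []. have n4 : 0 <= `|ln C| by [].
rewrite /D in hD; rewrite ler_norml.
set lV := ln (V j) in l1 l2 *; set lc := ln c in l1 n1 n3 hD *; set lC := ln C in l2 n2 n4 hD *.
by apply/andP; split; nra.
Unshelve. all: by end_near. Qed.

End LogLimit.

(** * Regularity bounds, and dyadic points near a minimizer *)

Section HolderAndCounting.
Context {R : realType}.

(** Where [q p = 0] the quotient is 0 by convention and says nothing about [n p]; the hypothesis on
    [n] covers those points. *)
Lemma ereal_sup_quotient_bound (T : Type) (D : set T) (n q : T -> R) :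
  (forall p, 0 <= q p) -> (forall p, D p -> q p = 0 -> n p <= 0) ->
  (ereal_sup [set (n p / q p)%:E | p in D] < +oo)%E ->
  exists C : R, 0 < C /\ forall p, D p -> n p <= C * q p.
Proof.
move=> q0 n0 sup_lt.
have [C hC] : exists C : R, forall p, D p -> n p / q p <= C.
  set E := [set _ | _ in D] in sup_lt.
  have ub p : D p -> ((n p / q p)%:E <= ereal_sup E)%E.
    by move=> Dp; apply: ereal_sup_ubound; exists p.
  case: (ereal_sup E) sup_lt ub => // [r|] _ ub.
    by exists r => p /ub; rewrite lee_fin.
  by exists 0 => p /ub; rewrite leeNy_eq.
exists (`|C| + 1); split; first by rewrite ltr_wpDl.
move=> p Dp; have [qp|qp] := eqVneq (q p) 0.
  by rewrite qp mulr0 n0.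
have qp0 : 0 < q p by rewrite lt_def qp q0.
rewrite -ler_pdivrMr// (le_trans (hC p Dp))// (le_trans (ler_norm C))//.
by rewrite lerDl.
Qed.

Lemma unif_holder_bound (H : R -> R) (I : set R) (x : R) : 0 <= x ->
  x < unif_holder H I ->
  exists g C : R, [/\ x < g, 0 < C & forall t1 t2, I t1 -> I t2 ->
    `|H t1 - H t2| <= C * `|t1 - t2| `^ g].
Proof.
move=> x0; rewrite /unif_holder; set E := [set _ | _] => xE.
have [g [/andP[g0 g1] gE] xg] : exists2 g, E g & x < g.
  (* The supremum of the empty set is 0 by default, which [0 <= x] excludes. *)
  apply: (sup_gt _ xE); apply/set0P/negP => /eqP E0.
  by move: xE; rewrite E0 sup0 ltNge x0.
have [||C [C0 hC]] := ereal_sup_quotient_bound _ _ gE.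
- by move=> p; exact: powR_ge0.
- move=> p _ /eqP; rewrite powR_eq0 => /andP[/eqP/normr0_eq0/subr0_eq -> _].
  by rewrite subrr normr0.
exists g, C; split=> // t1 t2 I1 I2.
by have := hC (t1, t2); apply; split.
Qed.

Lemma regular_path_lipschitz (alpha : R) (x : R -> R -> R) (a b c c' : R) :
  regular_path alpha x -> alpha^-1 < c -> c' < 1 ->
  exists L : R, 0 < L /\ forall u v1 v2, u \in `[a, b] -> v1 \in `[c, c'] ->
    v2 \in `[c, c'] -> `|x u v1 - x u v2| <= L * `|v1 - v2|.
Proof.
move=> [_ hx] ac c1; have := hx a b c c' ac c1.
move=> /ereal_sup_quotient_bound[||L [L0 hL]].
- by move=> p; exact: normr_ge0.
- by move=> p _ /normr0_eq0/subr0_eq ->; rewrite subrr normr0.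
exists L; split=> // u v1 v2 ub hv1 hv2.
by have := hL (u, (v1, v2)); apply; split.
Qed.

Lemma min_on_le (H : R -> R) (l a b t : R) : (forall t, l <= H t) ->
  t \in `[a, b] -> min_on H `[a, b] <= H t.
Proof.
move=> lH tab; apply: ge_inf; last by exists t.
by exists l => _ [s _ <-].
Qed.

Lemma le_max_on (H : R -> R) (u a b t : R) : (forall t, H t <= u) ->
  t \in `[a, b] -> H t <= max_on H `[a, b].
Proof.
move=> Hu tab; apply: ub_le_sup; last by exists t.
by exists u => _ [s _ <-].
Qed.

Lemma min_on_attained (H : R -> R) (a b : R) : a <= b -> continuous H ->
  exists2 t, t \in `[a, b] & H t <= min_on H `[a, b].
Proof.
move=> ab cH; have cw : {within `[a, b], continuous H} by exact: continuous_subspaceT.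
have [t tab ht] := EVT_min ab cw; exists t => //.
apply: lb_le_inf; first by exists (H t), t.
by move=> _ [s sab <-]; exact: ht.
Qed.

Lemma mesh_pow_le (B eta : R) : 0 < B -> 0 < eta ->
  \forall j \near \oo, (mesh j : R) `^ eta <= B.
Proof.
move=> B0 e0; have z1 : 2 `^ (- eta) < 1 :> R by rewrite powR2_lt1// oppr_lt0.
have z0 : 0 <= 2 `^ (- eta) :> R by exact: powR_ge0.
have : (fun n => (2 `^ (- eta)) ^+ n : R) @ \oo --> 0.
  by apply: cvg_expr; rewrite ger0_norm.
move=> /cvgr0Pnorm_le /(_ _ B0); apply: filterS => n.
by rewrite mesh_powR ger0_norm// exprn_ge0.
Qed.

(* All grid points within [delta] of a minimizer count, with [delta] independent
   of [j], and [b j - a j] is much larger than the mesh. *)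
Lemma count_near_min (H : R -> R) (a b : nat -> R) (j0 : nat) (g C eps : R) :
  0 < g -> 0 < C -> 0 < eps -> continuous H ->
  (forall j, `[a j.+1, b j.+1] `<=` `[a j, b j]) ->
  (forall j, 2 `^ (1 - j%:R / 2) <= b j - a j) ->
  (forall t1 t2, t1 \in `[a j0, b j0] -> t2 \in `[a j0, b j0] ->
    `|H t1 - H t2| <= C * `|t1 - t2| `^ g) ->
  exists kappa : R, 0 < kappa /\ \forall j \near \oo,
    let s := grid (a j) (b j) (mesh j) in
    let s' := [seq k <- s | H (k%:~R * mesh j) <= min_on H `[a j, b j] + eps] in
    (0 < size s)%N /\ kappa * (size s)%:R <= (size s')%:R.
Proof.
move=> g0 C0 e0 cH nest diam hol.
have ab j : a j < b j by rewrite -subr_gt0 (lt_le_trans _ (diam j))// powR_gt0.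
have step_ j : a j <= a j.+1 /\ b j.+1 <= b j.
  have h1 := nest j (a j.+1); have h2 := nest j (b j.+1).
  move: h1 h2; rewrite /= !in_itv/= !lexx ltW//= => /(_ isT)/andP[-> _].
  by move=> /(_ isT)/andP[_ ->].
have sub j : (j0 <= j)%N -> a j0 <= a j /\ b j <= b j0.
  elim: j => [|j ih]; first by rewrite leqn0 => /eqP ->.
  rewrite leq_eqVlt => /orP[/eqP ->//|]; rewrite ltnS => /ih[h1 h2].
  by have [h3 h4] := step_ j; split; [exact: le_trans h3|exact: le_trans h4 h2].
(* Chosen so that [C * delta ^ g = eps]: within [delta] of a minimizer, [H] exceeds its minimum by
   at most [eps]. *)
pose delta := (eps / C) `^ g^-1.
have d0 : 0 < delta by rewrite powR_gt0// divr_gt0.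
have deltag : C * delta `^ g = eps.
  rewrite /delta -powRrM mulVf ?gt_eqF// powRr1 ?divr_ge0 ?ltW//.
  by rewrite mulrC divfK// gt_eqF.
pose Lam := b j0 - a j0; have Lam0 : 0 < Lam by rewrite subr_gt0.
(* Makes [kap * (b j - a j)] at most both [b j - a j] and [delta] for every [j >= j0], as nestedness
   gives [b j - a j <= Lam]. *)
pose kap := Num.min 1 (delta / Lam).
have kap0 : 0 < kap by rewrite lt_min ltr01 divr_gt0.
have kap1 : kap <= 1 by rewrite ge_min lexx.
have kap2 : kap * Lam <= delta by rewrite -ler_pdivlMr// ge_min lexx orbT.
exists (kap / 2); split; first by rewrite divr_gt0.
have d4 : 0 < delta / 4 by rewrite divr_gt0.
near=> j.
have hm : (mesh j : R) <= delta / 4.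
  rewrite -[leLHS]powRr1 ?(ltW (mesh_gt0 j))//.
  by near: j; exact: mesh_pow_le.
have j2 : (2 <= j)%N by near: j; exact: nbhs_infty_ge.
have jj0 : (j0 <= j)%N by near: j; exact: nbhs_infty_ge.
have m0 : 0 < mesh j :> R := mesh_gt0 j.
(* The diameter condition enters here: 2^(2 - j) <= 2^(1 - j/2) once [j >= 2]. *)
have hba : 4 * mesh j <= b j - a j.
  apply: le_trans (diam j).
  have -> : 4 * mesh j = 2 `^ (2 - j%:R) :> R.
    rewrite powRD ?pnatr_eq0 ?implybT//.
    rewrite (_ : 2 `^ 2%:R = 2 ^+ 2) ?powR_mulrn// -(powRr1 (ltW m0)) mesh_powR.
    by rewrite -powR_mulrn ?powR_ge0// -powRrM mulN1r; congr (_ * _); ring.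
  rewrite ler_powR ?ler1n//.
  have : 2 <= j%:R :> R by rewrite ler_nat.
  by lra.
have [sa sb] := sub j jj0.
have [t] := min_on_attained (ltW (ab j)) cH; rewrite in_itv/= => /andP[ta tb] ht.
move=> /=; set s := grid _ _ _; set s' := [seq _ <- _ | _].
(* [[p, q]] is the part of the interval within [delta] of the minimizer [t]. It is at least four
   meshes long, so the two indices lost to rounding cost at most half of the count; hence the
   constant [kap / 2]. *)
pose p := Num.max (a j) (t - delta); pose q := Num.min (b j) (t + delta).
have pq1 : kap * (b j - a j) <= q - p.
  have k1 : kap * (b j - a j) <= b j - a j by rewrite ler_piMl// subr_ge0 ltW.
  have k2 : kap * (b j - a j) <= delta.
    by apply: le_trans kap2; rewrite ler_wpM2l ?(ltW kap0)// /Lam; lra.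
  by rewrite /p /q; case: (lerP (a j) (t - delta)); case: (lerP (b j) (t + delta)); lra.
have pq2 : 4 * mesh j <= q - p.
  by rewrite /p /q; case: (lerP (a j) (t - delta)); case: (lerP (b j) (t + delta)); lra.
have subs : {subset grid p q (mesh j) <= s'}.
  move=> k; rewrite mem_grid// mem_filter mem_grid// => /andP[pk kq].
  have kk : k%:~R * mesh j <= (k + 1)%:~R * mesh j :> R.
    by rewrite ler_pM2r// ler_int lerDl.
  move: pk kq; rewrite /p /q ge_max le_min => /andP[k1 k2] /andP[k3 k4].
  rewrite k1 k3 !andbT; apply: le_trans (lerD ht (lexx eps)).
  have hd : `|k%:~R * mesh j - t| <= delta.
    by rewrite ler_norml; apply/andP; split; lra.
  have := hol (k%:~R * mesh j) t.
  rewrite !in_itv/= => /(_ _ _)/le_trans H1.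
  have H2 : `|H (k%:~R * mesh j) - H t| <= eps.
    apply: H1.
    - by apply/andP; split; lra.
    - by apply/andP; split; lra.
    - rewrite -deltag ler_wpM2l ?(ltW C0)//.
      by rewrite ge0_ler_powR ?nnegrE ?(ltW g0) ?(ltW d0).
  by have := ler_norm (H (k%:~R * mesh j) - H t); lra.
have sz1 : (size (grid p q (mesh j)))%:R <= (size s')%:R :> R.
  by rewrite ler_nat uniq_leq_size// grid_uniq.
have sz2 := size_grid_ge p q m0.
have sz3 : (size s)%:R <= (b j - a j) / mesh j by apply: size_grid_le => //; exact: ltW.
have h4 : 4 <= (q - p) / mesh j by rewrite ler_pdivlMr.
have h5 : kap * (b j - a j) / mesh j <= (q - p) / mesh j.
  by rewrite ler_pM2r ?invr_gt0.
split.
  have : 0 < (size s')%:R :> R by lra.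
  by rewrite ltr0n => /leq_trans; apply; rewrite size_filter count_size.
have h6 : kap * (size s)%:R <= kap * ((b j - a j) / mesh j) by rewrite ler_wpM2l ?(ltW kap0).
rewrite mulrA in h6.
by rewrite mulrAC; lra.
Unshelve. all: by end_near. Qed.

End HolderAndCounting.

(** * Deterministic bounds along a single path *)

Section PathwiseBounds.
Context {R : realType}.

Lemma powR_add_le (x y beta : R) : 0 <= x -> 0 <= y -> 0 < beta -> beta <= 1 ->
  (x + y) `^ beta <= 2 * (x `^ beta + y `^ beta).
Proof.
move=> x0 y0 b0 b1.
have h (u v : R) : 0 <= u -> u <= v -> (u + v) `^ beta <= 2 * v `^ beta.
  move=> u0 uv; have v0 := le_trans u0 uv.
  apply: (@le_trans _ _ ((2 * v) `^ beta)).
    by rewrite ge0_ler_powR ?nnegrE ?(ltW b0)//; lra.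
  by rewrite powRM// ler_wpM2r ?powR_ge0// ler1_powR// ler1n.
have [xy|yx] := lerP x y.
  by apply: le_trans (h _ _ x0 xy) _; rewrite ler_pM2l// lerDr powR_ge0.
by rewrite addrC; apply: le_trans (h _ _ y0 (ltW yx)) _; rewrite ler_pM2l// lerDl powR_ge0.
Qed.

Variables (beta D g Mx : R) (j0 : nat) (s : nat -> seq int) (h : nat -> R)
  (v f e : nat -> int -> R).
Hypotheses (b0 : 0 < beta) (b1 : beta <= 1) (D0 : 0 <= D) (Mg : Mx < g).
Hypothesis hM : forall j, (j0 <= j)%N -> h j <= Mx.
Hypothesis dist : forall j k, (j0 <= j)%N -> k \in s j ->
  `|e j k - f j k| <= D * mesh j `^ g.
Hypothesis count : forall eps : R, 0 < eps -> exists kappa : R, 0 < kappa /\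
  \forall j \near \oo,
    (0 < size (s j))%N /\
    kappa * (size (s j))%:R <= (size [seq k <- s j | (v j k <= h j + eps)%R])%:R.
Hypothesis upper : forall n : nat, let eps := n.+1%:R^-1 in
  (size (s j))%:R^-1 * \sum_(k <- s j)
    mesh j `^ (- (beta * (h j - eps))) * `|f j k| `^ beta @[j --> \oo] --> 0.
Hypothesis lower : forall n : nat, let eps := n.+1%:R^-1 in
  let s' j := [seq k <- s j | v j k <= h j + eps] in
  (size (s' j))%:R^-1 * \sum_(k <- s' j)
    ((`|f j k| <= mesh j `^ (v j k + 2 * eps) / 8)%R)%:R @[j --> \oo] --> (0 : R).

Let V j := (size (s j))%:R^-1 * \sum_(k <- s j) `|e j k| `^ beta.

(** The freezing error contributes a power of the mesh with exponent [g * beta], negligible because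
    [h j <= Mx < g]. *)
Lemma V_upper (eps : R) : 0 < eps -> exists2 C, 0 < C &
  \forall j \near \oo, V j <= C * mesh j `^ (beta * (h j - eps)).
Proof.
move=> e0; pose n := Num.truncn eps^-1; pose ep : R := n.+1%:R^-1.
have ep0 : 0 < ep by rewrite invr_gt0.
have epe : ep <= eps.
  by rewrite invf_ple ?posrE// ltW// truncnS_gt.
exists (2 * (1 + D `^ beta)); first by rewrite mulr_gt0// ltr_wpDr ?powR_ge0.
have /cvgr0Pnorm_le /(_ _ ltr01) nearU := upper n.
have [kap [_ nearS]] := count e0.
near=> j.
have jj0 : (j0 <= j)%N by near: j; exact: nbhs_infty_ge.
have U1 : `|(size (s j))%:R^-1 * \sum_(k <- s j)
    mesh j `^ (- (beta * (h j - ep))) * `|f j k| `^ beta| <= 1 by near: j.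
have [s0 _] : (0 < size (s j))%N /\
    kap * (size (s j))%:R <= (size [seq k <- s j | (v j k <= h j + eps)%R])%:R by near: j.
have m0 : 0 < mesh j :> R := mesh_gt0 j.
have sR : 0 < (size (s j))%:R :> R by rewrite ltr0n.
rewrite -mulr_sumr mulrCA powRN in U1.
have p0 : 0 < mesh j `^ (beta * (h j - ep)) by exact: powR_gt0.
have F1 : (size (s j))%:R^-1 * \sum_(k <- s j) `|f j k| `^ beta <=
    mesh j `^ (beta * (h j - ep)).
  by have := le_trans (ler_norm _) U1; rewrite ler_pdivrMl// mulr1.
have F2 : (size (s j))%:R^-1 * \sum_(k <- s j) `|f j k| `^ beta <=
    mesh j `^ (beta * (h j - eps)).
  by apply: le_trans F1 _; rewrite ler_mesh_powR// ler_pM2l//; lra.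
have hMj := hM jj0.
have G1 : mesh j `^ (g * beta) <= mesh j `^ (beta * (h j - eps)).
  rewrite ler_mesh_powR// mulrC ler_pM2r//; move: hMj Mg e0; lra.
apply: (@le_trans _ _ ((size (s j))%:R^-1 * \sum_(k <- s j)
    (2 * (`|f j k| `^ beta + D `^ beta * mesh j `^ (g * beta))))).
  rewrite ler_wpM2l ?invr_ge0// big_seq [leRHS]big_seq; apply: ler_sum => k ks.
  apply: (@le_trans _ _ ((`|f j k| + D * mesh j `^ g) `^ beta)).
    rewrite ge0_ler_powR ?nnegrE ?(ltW b0) ?addr_ge0 ?mulr_ge0 ?powR_ge0//.
    rewrite -lerBlDl; apply: le_trans (dist jj0 ks).
    by rewrite lerBlDr -{1}(subrK (f j k) (e j k)) ler_normD.
  rewrite (powRrM (mesh j)) -powRM ?powR_ge0//.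
  by apply: powR_add_le => //; rewrite mulr_ge0 ?powR_ge0.
rewrite -mulr_sumr big_split/= big_const_seq count_predT iter_addr addr0.
rewrite -[D `^ beta * _ *+ _]mulr_natl mulrCA mulrDr mulKf ?gt_eqF// -mulrA.
rewrite ler_pM2l// mulrDl mul1r lerD// ler_wpM2l ?powR_ge0//.
Unshelve. all: by end_near. Qed.

Lemma V_lower (eps : R) : 0 < eps -> exists2 c, 0 < c &
  \forall j \near \oo, c * mesh j `^ (beta * (h j + eps)) <= V j.
Proof.
move=> e0.
(* Of the three [e1], one pays for [v j k <= h j + ep] and two for the small ball threshold. Keeping
   [3 * e1] below [(g - Mx) / 2] leaves a spare power of the mesh with that same exponent, which
   beats the constant [D]. *)
pose e1 := Num.min eps ((g - Mx) / 2) / 3.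
have e10 : 0 < e1 by rewrite divr_gt0// lt_min e0 divr_gt0// subr_gt0.
have e1e : 3 * e1 <= eps by rewrite /e1 mulrC divfK// ge_min lexx.
have e1g : 3 * e1 <= (g - Mx) / 2 by rewrite /e1 mulrC divfK// ge_min lexx orbT.
pose n := Num.truncn e1^-1; pose ep : R := n.+1%:R^-1.
have ep0 : 0 < ep by rewrite invr_gt0.
have epe : ep <= e1 by rewrite invf_ple ?posrE// ltW// truncnS_gt.
have [kap [kap0 nearS]] := count ep0.
exists (kap / 2 * 16^-1 `^ beta).
  by rewrite mulr_gt0 ?divr_gt0// powR_gt0// invr_gt0.
have half : 0 < 2^-1 :> R by rewrite invr_gt0.
have /cvgr0Pnorm_le /(_ _ half) nearL := lower n.
have D1 : 0 < D + 1 by rewrite ltr_wpDl.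
have B0 : 0 < (16 * (D + 1))^-1 by rewrite invr_gt0 mulr_gt0.
have eta0 : 0 < (g - Mx) / 2 by rewrite divr_gt0// subr_gt0.
have nearM := mesh_pow_le B0 eta0.
near=> j.
have jj0 : (j0 <= j)%N by near: j; exact: nbhs_infty_ge.
have [s0 sk] : (0 < size (s j))%N /\
    kap * (size (s j))%:R <= (size [seq k <- s j | (v j k <= h j + ep)%R])%:R by near: j.
have L1 : `|(size [seq k <- s j | (v j k <= h j + ep)%R])%:R^-1 *
    \sum_(k <- [seq k <- s j | (v j k <= h j + ep)%R])
      ((`|f j k| <= mesh j `^ (v j k + 2 * ep) / 8)%R)%:R| <= 2^-1 :> R by near: j.
pose s' := [seq k <- s j | v j k <= h j + ep]; rewrite -/s' in L1 sk.
have M1 : mesh j `^ ((g - Mx) / 2) <= (16 * (D + 1))^-1 by near: j.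
have m0 : 0 < mesh j :> R := mesh_gt0 j.
have sR : 0 < (size (s j))%:R :> R by rewrite ltr0n.
have s'R : 0 < (size s')%:R :> R by apply: lt_le_trans sk; exact: mulr_gt0.
have hMj := hM jj0.
pose q := mesh j `^ (h j + 3 * e1).
have q0 : 0 < q by exact: powR_gt0.
have Dq : D * mesh j `^ g <= q / 16.
  have : mesh j `^ g <= q * mesh j `^ ((g - Mx) / 2).
    rewrite /q -powRD ?(gt_eqF m0) ?implybT// ler_mesh_powR//; lra.
  move=> h1; apply: (@le_trans _ _ ((D + 1) * (q * (16 * (D + 1))^-1))).
    rewrite ler_pM ?powR_ge0//; first by rewrite lerDl.
    by apply: le_trans h1 _; rewrite ler_pM2l.
  by rewrite le_eqVlt; apply/orP; left; apply/eqP; field; rewrite gt_eqF.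
have good k : k \in s' -> (q / 16) `^ beta *
    (1 - ((`|f j k| <= mesh j `^ (v j k + 2 * ep) / 8)%R)%:R) <= `|e j k| `^ beta.
  rewrite mem_filter => /andP[vk ks].
  have [fk|fk] := lerP `|f j k| (mesh j `^ (v j k + 2 * ep) / 8); first by rewrite subrr mulr0 powR_ge0.
  rewrite subr0 mulr1 ge0_ler_powR ?nnegrE ?(ltW b0) ?divr_ge0 ?(ltW q0)//.
  have h1 : q / 8 < `|f j k|.
    apply: le_lt_trans fk; rewrite ler_pM2r ?invr_gt0//.
    by rewrite /q ler_mesh_powR//; lra.
  have h2 := le_trans (dist jj0 ks) Dq.
  have h3 : `|f j k| <= `|e j k| + `|e j k - f j k|.
    by rewrite -{1}(subKr (e j k) (f j k)) ler_normB.
  lra.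
have V1 : (q / 16) `^ beta * ((size s')%:R / 2) <= \sum_(k <- s j) `|e j k| `^ beta.
  apply: (@le_trans _ _ (\sum_(k <- s') `|e j k| `^ beta)); last first.
    rewrite big_filter [leRHS](bigID (fun k => v j k <= h j + ep))/=.
    by rewrite lerDl sumr_ge0// => k _; exact: powR_ge0.
  apply: (@le_trans _ _ (\sum_(k <- s') (q / 16) `^ beta *
    (1 - ((`|f j k| <= mesh j `^ (v j k + 2 * ep) / 8)%R)%:R))); last first.
    by rewrite big_seq [leRHS]big_seq; exact: ler_sum.
  rewrite -mulr_sumr ler_wpM2l ?powR_ge0// sumrB.
  rewrite big_const_seq count_predT iter_addr addr0.
  have := le_trans (ler_norm _) L1; rewrite ler_pdivrMl//.
  by set S := \sum_(_ <- _) _; lra.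
have qE : (q / 16) `^ beta = 16^-1 `^ beta * mesh j `^ (beta * (h j + 3 * e1)).
  by rewrite powRM ?(ltW q0) ?invr_ge0// mulrC /q -powRrM (mulrC beta).
rewrite /V -ler_pdivrMl ?invr_gt0// invrK; apply: le_trans V1.
have m1 : mesh j `^ (beta * (h j + eps)) <= mesh j `^ (beta * (h j + 3 * e1)).
  by rewrite ler_mesh_powR// ler_pM2l//; lra.
rewrite qE.
apply: (@le_trans _ _ ((size (s j))%:R * (kap / 2 * 16^-1 `^ beta *
    mesh j `^ (beta * (h j + 3 * e1))))).
  rewrite ler_pM2l// ler_pM2l// mulr_gt0 ?divr_gt0// powR_gt0// invr_gt0//.
set A := 16^-1 `^ beta; set B := mesh j `^ _.
have AB0 : 0 <= A * B by rewrite mulr_ge0 ?powR_ge0.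
rewrite (_ : (size (s j))%:R * _ = A * B * (kap * (size (s j))%:R / 2)); last by ring.
by rewrite ler_wpM2l// ler_pM2r ?invr_gt0.
Unshelve. all: by end_near. Qed.

Lemma pathwise_limit :
  (fun j => `|log2 (V j) / (- j%:R * beta) - h j|) @ \oo --> (0 : R).
Proof.
apply: log2_cvg => // eps e0.
have [C C0 hC] := V_upper e0; have [c c0 hc] := V_lower e0.
exists c, C; split=> //; apply: filterS2 hc hC => j h1 h2.
by rewrite h1 h2.
Qed.

End PathwiseBounds.

(** * From pathwise bounds to the almost sure limit *)

Unset Implicit Arguments.

Theorem theorem1p1 (R : realType) (d : measure_display)
    (Omega : measurableType d) (P : probability Omega R)
    (alpha : R) (halpha : 1 < alpha < 2)
    (Z : R -> {RV P >-> R})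
    (hZ : levy_process Z) (hZnorm : SaS_normalized P alpha Z)
    (X : R -> R -> Omega -> R) (hX : SaS_field P alpha Z X)
    (H : R -> R) (Hlow Hup : R)
    (hHlow : alpha^-1 < Hlow) (hHup : Hup < 1)
    (hHrange : forall t, H t \in `[Hlow, Hup]) (hHcont : continuous H)
    (psi : R -> R) (hpsi : analyzing_wavelet psi)
    (beta : R) (hbeta : 0 < beta < alpha / 4)
    (a b : nat -> R)
    (hnested : forall j : nat, `[a j.+1, b j.+1] `<=` `[a j, b j])
    (hdiam : forall j : nat, 2 `^ (1 - j%:R / 2) <= b j - a j)
    (hholder : exists j0 : nat,
      max_on H `[a j0, b j0] < unif_holder H `[a j0, b j0]) :
  \forall w \ae P,
    (fun j : nat =>
       `| log2 (V_stat beta psi (fun t => lmsm X H t w) `[a j, b j] j%:Z)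
            / (- j%:R * beta)
          - min_on H `[a j, b j] |) @ \oo --> (0 : R).
Proof.
have /andP[alpha1 alpha2] := halpha; have /andP[b0 b4] := hbeta.
have [cpsi psi_neq0 psi0 int_psi0 _] := hpsi.
have ba : beta < alpha by lra.
have b1 : beta <= 1 by lra.
have ai0 : 0 < alpha^-1 by rewrite invr_gt0; lra.
have Hl t : Hlow <= H t by have := hHrange t; rewrite in_itv/= => /andP[].
have Hu t : H t <= Hup by have := hHrange t; rewrite in_itv/= => /andP[].
have Hstrip t : alpha^-1 < H t < 1.
  by rewrite (lt_le_trans hHlow (Hl t)) (le_lt_trans (Hu t) hHup).
have ab j : a j <= b j by rewrite -subr_ge0 (le_trans _ (hdiam j))// powR_ge0.
have [j0 hol] := hholder.
set Mx := max_on _ _ in hol.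
have aj0 : a j0 \in `[a j0, b j0] by rewrite in_itv/= lexx ab.
have Mx0 : 0 < Mx.
  apply: lt_le_trans (le_max_on Hu aj0); apply: lt_le_trans (Hl _).
  exact: lt_trans hHlow.
have [g [C [Mg C0 hC]]] := unif_holder_bound (ltW Mx0) hol.
have g0 : 0 < g by exact: lt_trans Mg.
have sub j : (j0 <= j)%N -> `[a j, b j] `<=` `[a j0, b j0].
  elim: j => [|j ih]; first by rewrite leqn0 => /eqP ->.
  rewrite leq_eqVlt => /orP[/eqP ->//|]; rewrite ltnS => /ih h.
  exact: subset_trans (hnested j) h.
pose s j := grid (a j) (b j) (mesh j).
pose h j := min_on H `[a j, b j].
have s_itv j k t : k \in s j ->
    t \in `[k%:~R * mesh j, (k + 1)%:~R * mesh j] -> t \in `[a j, b j].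
  rewrite /s mem_grid ?mesh_gt0// !in_itv/= => /andP[h1 h2] /andP[h3 h4].
  by rewrite (le_trans h1 h3) (le_trans h4 h2).
have node_itv j (k : int) :
    k%:~R * mesh j \in `[k%:~R * mesh j, (k + 1)%:~R * mesh j : R].
  by rewrite in_itv/= lexx/= ler_pM2r ?mesh_gt0// ler_int lerDl.
have hs j k : k \in s j -> h j <= H (k%:~R * mesh j).
  by move=> ks; apply: (min_on_le Hl); apply: (s_itv _ _ _ ks); exact: node_itv.
have e0 n : 0 < n.+1%:R^-1 :> R by rewrite invr_gt0.
have U n := frozen_upper alpha1 hZnorm hX cpsi psi0 int_psi0 psi_neq0 hHlow hHup
  hHrange b0 ba (e0 n) hs.
(* The near-minimal points depend on [H] alone, not on the path, so [frozen_lower] applies to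
   them. *)
have L n := frozen_lower alpha1 hZnorm hX cpsi psi0 int_psi0 psi_neq0 hHlow hHup
  hHrange (fun j => [seq k <- s j | H (k%:~R * mesh j) <= h j + n.+1%:R^-1]) (e0 n).
apply: filterS2 (ae_foralln U) (ae_foralln L) => w Uw Lw.
have [K [K0 hK]] := regular_path_lipschitz (a j0) (b j0) (proj2 hX w) hHlow hHup.
under eq_fun do rewrite V_stat_grid.
(* [K] is the Lipschitz constant of this path in the exponent and [C] the Hölder constant of [H].
   Their product with the mesh to the power [g] bounds the freezing error pointwise, and [D] may
   depend on the path since the argument is now deterministic. *)
apply: (pathwise_limit (D := \int[lebesgue_measure]_x `|psi x| * (K * C))
  (f := fun j k => frozen_coeff X psi H j k w)
  (v := fun j k => H (k%:~R * mesh j)) (j0 := j0) b0 b1 _ Mg) => //.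
- by rewrite !mulr_ge0 ?Rintegral_ge0 ?(ltW K0) ?(ltW C0).
- move=> j jj0; have [t tj ht] := min_on_attained (ab j) hHcont.
  apply: (@le_trans _ _ (H t)); first exact: (min_on_le Hl).
  by apply: (le_max_on Hu); apply: (sub j jj0).
- move=> j k jj0 ks.
  pose y1 t := X t (H t) w; pose y2 t := X t (H (k%:~R * mesh j)) w.
  have cy1 : continuous y1 by exact: (regular_path_continuous (proj2 hX w)).
  have cy2 : continuous y2.
    by apply: (regular_path_continuous (proj2 hX w) (g := fun=> H (k%:~R * mesh j))) => // t; exact: cvg_cst.
  have -> : frozen_coeff X psi H j k w = wavelet_coeff psi y2 j%:Z k.
    by rewrite wavelet_coeffE.
  rewrite -[X in _ <= X]mulrA.
  apply: wavelet_coeff_dist_le => // t tk.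
  have tI := sub j jj0 _ (s_itv _ _ _ ks tk).
  have kI := sub j jj0 _ (s_itv _ _ _ ks (node_itv j k)).
  apply: le_trans (hK _ _ _ tI (hHrange t) (hHrange _)) _.
  rewrite -mulrA ler_wpM2l ?(ltW K0)//.
  apply: le_trans (hC _ _ tI kI) _; rewrite ler_wpM2l ?(ltW C0)//.
  rewrite ge0_ler_powR ?nnegrE ?(ltW g0) ?(ltW (mesh_gt0 j))//.
  move: tk; rewrite in_itv/= => /andP[t1 t2]; rewrite ger0_norm ?subr_ge0//.
  by rewrite lerBlDl (le_trans t2)// intrD mulrDl mul1r.
- by move=> eps eps0; exact: (count_near_min g0 C0 eps0 hHcont hnested hdiam hC).
- move=> n eps s'; apply: cvg_trans (Lw n).
  apply: near_eq_cvg; apply: nearW => j; congr (_ * _); apply: eq_bigr => k _.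
  rewrite indicE; congr ((nat_of_bool _)%:R).
  by apply/idP/idP; rewrite inE.
Qed.
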